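(* Let $0\le k\le n$ be integers with $n\ge 1$, and let $X\in G_k(\mathbb{C}^n)$. If the torus orbit closure $\overline{TX}$ is smooth, then there exist a partition $(J_1,J_2,\dots,J_r)$ of the set $[n]=\{1,\dots,n\}$ and non-negative integers $k_1,\dots,k_r$ with $k_1+\dots+k_r=k$ and $k_i\in\{0,1,|J_i|-1,|J_i|\}$ for each $i$, such that $$\overline{TX}=G_{k_1}(\mathbb{C}^{J_1})\times G_{k_2}(\mathbb{C}^{J_2})\times\cdots\times G_{k_r}(\mathbb{C}^{J_r})$$ as subvarieties of $G_k(\mathbb{C}^n)$. In particular, $\overline{TX}$ is isomorphic to a product of complex projective spaces (where a point is regarded as a projective space of dimension $0$).
   Context: For a finite-dimensional complex vector space $E$, $G_k(E)$ denotes the Grassmannian of $k$-dimensional complex linear subspaces of $E$. $T=(\mathbb{C}^* )^n$ acts on $\mathbb{C}^n$ by coordinatewise multiplication (i.e. $T$ is the group of non-singular diagonal matrices in $\mathrm{GL}(\mathbb{C}^n)$), and hence acts on $G_k(\mathbb{C}^n)$. $TX$ is the $T$-orbit of $X$ and $\overline{TX}$ is its closure in $G_k(\mathbb{C}^n)$, regarded as a (reduced) subvariety. A partition of a set is a decomposition into pairwise disjoint nonempty subsets whose union is the set. For $J\subset[n]$, $\mathbb{C}^J$ is the space of complex-valued functions on $J$. For a partition $(J_1,\dots,J_r)$ of $[n]$ we identify $\mathbb{C}^{J_1}\times\cdots\times\mathbb{C}^{J_r}$ with $\mathbb{C}^n$, and for $k_i\le|J_i|$ with $\sum_i k_i=k$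 the product $G_{k_1}(\mathbb{C}^{J_1})\times\cdots\times G_{k_r}(\mathbb{C}^{J_r})$ is regarded as a subvariety of $G_k(\mathbb{C}^n)$ via $(X_1,\dots,X_r)\mapsto X_1\oplus\cdots\oplus X_r$. *)

(* Defs.v *)
(* Varieties are classical: sets of closed points over a field
   [F], algebraically closed in the intended use, glued from affine charts and
   carrying the Zariski topology. *)
From HB Require Import structures.
From mathcomp Require Import all_boot all_order all_algebra.
From mathcomp Require Import classical_sets reals complex mpoly.

Set Implicit Arguments.
Unset Strict Implicit.
Unset Printing Implicit Defensive.

Import GRing.Theory.

Definition ordered_partition (n r : nat) (J : 'I_r -> {set 'I_n}) : Prop :=
  [/\ forall i, J i != finset.set0,
      forall i j, i != j -> J i :&: J j = finset.set0
    & \bigcup_(i < r) J i = [set: 'I_n]].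

Local Open Scope classical_set_scope.
Local Open Scope ring_scope.

(* Affine space with coordinates indexed by a finite type; [F^o] only serves to
   give the function space its vector space structure. *)
Notation affine F I := {ffun I -> F^o}.
Notation poly_on F I := {mpoly F[#|I : finType|]}.

Section AffineSets.
Variables (F : fieldType) (I : finType).
Implicit Types (p : poly_on F I) (x v : affine F I) (Z : set (affine F I)).

Definition peval p x : F := p.@[fun a => x (enum_val a)].

Definition algebraic_set Z : Prop :=
  exists S : set (poly_on F I), Z = [set x | forall p, S p -> peval p x = 0].

Definition vanishing_ideal Z : set (poly_on F I) :=
  [set p | forall x, Z x -> peval p x = 0].

Definition differential p x v : F :=
  \sum_(a < #|I|) peval p^`M(a) x * v (enum_val a).

(* The whole vanishing ideal is used, so this is the tangent space of [Z] with
   its reduced structure. *)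
Definition is_tangent_space Z x (T : {vspace affine F I}) : Prop :=
  forall v, v \in T <-> forall p, vanishing_ideal Z p -> differential p x v = 0.

End AffineSets.

(* A space covered by affine spaces.  The gluing axioms (charts injective with
   Zariski open image, transition maps rational, charts jointly surjective) are
   not recorded: the only instances are Grassmannians with their standard
   charts, and finite products of those. *)
Record charted (F : fieldType) := Charted {
  carrier :> Type;
  chart_index : Type;
  chart_coord : chart_index -> finType;
  chart : forall c : chart_index, affine F (chart_coord c) -> carrier
}.
Arguments chart_coord {F M} c : rename.
Arguments chart {F M} c x : rename.

Section Zariski.
Variables (F : fieldType) (M : charted F).
Implicit Types (A B Z : set M) (p : M).

Definition zclosed Z : Prop :=
  forall c : chart_index M, algebraic_set (chart c @^-1` Z).

Definition zclosure A : set M :=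
  [set p | forall Z, zclosed Z -> A `<=` Z -> Z p].

Definition zirreducible Z : Prop :=
  Z !=set0 /\
  forall A B, zclosed A -> zclosed B -> Z `<=` A `|` B -> Z `<=` A \/ Z `<=` B.

Definition irreducible_chain Z p (d : nat) : Prop :=
  exists W : nat -> set M,
    (forall i, (i <= d)%N ->
       [/\ zclosed (W i), zirreducible (W i), W i p & W i `<=` Z]) /\
    (forall i, (i < d)%N -> W i `<` W i.+1).

(* For [Z] closed, the Krull dimension of the local ring of [Z] at [p]. *)
Definition has_local_dim Z p (d : nat) : Prop :=
  irreducible_chain Z p d /\
  forall e, irreducible_chain Z p e -> (e <= d)%N.

(* For [Z] closed: every local ring is regular. *)
Definition smooth Z : Prop :=
  forall (c : chart_index M) (x : affine F (chart_coord c)), Z (chart c x) ->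
    exists T, is_tangent_space (chart c @^-1` Z) x T /\
              has_local_dim Z (chart c x) (\dim T).

End Zariski.

Section Morphisms.
Variables (F : fieldType) (M N : charted F).

(* Near each point of [Z], [f] is given in charts by fractions of polynomials
   with a common denominator; the values of [f] off [Z] are irrelevant. *)
Definition regular_on (Z : set M) (f : M -> N) : Prop :=
  forall p, Z p ->
    exists (c : chart_index M) (x : affine F (chart_coord c))
           (c' : chart_index N)
           (P : chart_coord c' -> poly_on F (chart_coord c))
           (Q : poly_on F (chart_coord c)),
      [/\ chart c x = p, peval Q x != 0
        & forall y, Z (chart c y) -> peval Q y != 0 ->
            f (chart c y) = chart c' [ffun b => peval (P b) y / peval Q y]].

End Morphisms.

Definition isomorphic (F : fieldType) (M N : charted F)
    (Z : set M) (Z' : set N) : Prop :=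
  exists (f : M -> N) (g : N -> M),
    [/\ regular_on Z f, regular_on Z' g,
        (forall p, Z p -> Z' (f p) /\ g (f p) = p)
      & (forall q, Z' q -> Z (g q) /\ f (g q) = q)].

Definition prod_charted (F : fieldType) (r : nat) (M : 'I_r -> charted F) :
    charted F :=
  @Charted F (forall i, M i) (forall i, chart_index (M i))
    (fun c => {i : 'I_r & chart_coord (c i)} : finType)
    (fun c x i => chart (c i)
       [ffun a => x (Tagged (fun i => chart_coord (c i) : Type) a)]).

Section ExtensionByZero.
Variables (F : fieldType) (J : finType) (P : pred J).

Definition extend0 (u : affine F {j : J | P j}) : affine F J :=
  [ffun l => if insub l is Some j then u j else 0].

Fact extend0_is_linear : linear extend0.
Proof.
move=> a u v; apply/ffunP => l; rewrite !ffunE.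
by case: insubP => [j _ _|_]; rewrite ?ffunE // scaler0 addr0.
Qed.

HB.instance Definition _ :=
  GRing.isLinear.Build F (affine F {j : J | P j}) (affine F J) *:%R
    extend0 extend0_is_linear.

End ExtensionByZero.

Section Grassmannian.
Variables (F : fieldType) (J : finType) (k : nat).

Definition Gr_point : Type := {V : {vspace affine F J} | \dim V == k}.

Definition Gr_index : Type := {I : {set J} | #|I| == k}.

Definition Gr_coord (c : Gr_index) : finType :=
  ({i : J | i \in val c} * {j : J | j \notin val c})%type : finType.

(* With I = [val c] and [A] the matrix of a linear map F^I -> F^(J \ I), the
   chart sends [A] to the graph of that map in F^I + F^(J \ I) = F^J. *)
Definition graph_map (c : Gr_index) (A : affine F (Gr_coord c))
    (u : affine F {i : J | i \in val c}) : affine F J :=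
  extend0 u +
  extend0 ([ffun j => \sum_i u i * A (i, j)] : affine F {j : J | j \notin val c}).

Fact graph_map_is_linear c A : linear (@graph_map c A).
Proof.
move=> a u v; apply/ffunP => l; rewrite !ffunE.
case: insubP => [i li _|lI]; case: insubP => [j lj _|lJ].
- by rewrite li in lj.
- by rewrite !ffunE !addr0.
- rewrite !ffunE !add0r scaler_sumr -big_split.
  by apply: eq_bigr => i _; rewrite !ffunE mulrDl -scalerAl.
- by rewrite (negbTE lI) in lJ.
Qed.

HB.instance Definition _ c A :=
  GRing.isLinear.Build F _ _ *:%R (@graph_map c A) (@graph_map_is_linear c A).

Fact graph_map_inj c A : injective (@graph_map c A).
Proof.
move=> u v /ffunP uv; apply/ffunP => i; move: (uv (val i)); rewrite !ffunE.
by rewrite valK insubF ?addr0 // (valP i).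
Qed.

Fact dim_graph c A : \dim (linfun (@graph_map c A) @: fullv) == k.
Proof.
rewrite limg_dim_eq; last first.
  apply/eqP; rewrite -subv0; apply/subvP => u; rewrite memv_cap memv_ker.
  case/andP=> _ /eqP; rewrite lfunE /= -(linear0 (@graph_map c A)).
  by move/graph_map_inj => ->; rewrite mem0v.
by rewrite dimvf /dim /= /dim /= muln1 card_sig (eqP (valP c)).
Qed.

Definition Gr : charted F :=
  @Charted F Gr_point Gr_index Gr_coord
    (fun c A => exist (fun V : {vspace affine F J} => \dim V == k)
                      (linfun (graph_map A) @: fullv)%VS (dim_graph A)).

End Grassmannian.

(* P^m, as the space of lines in F^(m+1). *)
Definition proj_space (F : fieldType) (m : nat) : charted F := Gr F 'I_m.+1 1.

Section TorusOrbit.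
Variables (F : fieldType) (n k : nat).

Definition diag_act (t : 'I_n -> F) (v : affine F 'I_n) : affine F 'I_n :=
  [ffun i => t i * v i].

Fact diag_act_is_linear t : linear (diag_act t).
Proof.
move=> a u v; apply/ffunP => i; rewrite !ffunE mulrDr; congr (_ + _).
exact: mulrCA.
Qed.

HB.instance Definition _ t :=
  GRing.isLinear.Build F _ _ *:%R (diag_act t) (diag_act_is_linear t).

Definition torus_orbit (X : Gr F 'I_n k) : set (Gr F 'I_n k) :=
  [set Y | exists t : 'I_n -> F, (forall i, t i != 0) /\
             val Y = (linfun (diag_act t) @: val X)%VS].

Definition orbit_closure (X : Gr F 'I_n k) : set (Gr F 'I_n k) :=
  zclosure (torus_orbit X).

(* The product of the G_(kk i)(F^(J i)), as a subset of G_k(F^n) by direct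
   sum; F^(J i) sits in F^n by extension by zero. *)
Definition Gr_product (r : nat) (J : 'I_r -> {set 'I_n}) (kk : 'I_r -> nat) :
    set (Gr F 'I_n k) :=
  [set W | exists Y : forall i, Gr F {x : 'I_n | x \in J i} (kk i),
     val W = (\sum_i linfun (@extend0 F 'I_n (mem (J i))) @: val (Y i))%VS].

End TorusOrbit.

(* Main.v *)
Require Import Defs.
From mathcomp Require Import all_boot all_order all_algebra.
From mathcomp Require Import boolp classical_sets reals complex mpoly.
From mathcomp Require Import ring zify.

(* In the standard chart at a coordinate subset I, let Y be the matrix of X.  If two
   rows and two columns of Y met in four nonzero entries, then at the T-fixed point
   of the chart the closure of TX would contain every coordinate axis with
   Y i j <> 0, so its tangent space would have dimension at least the number s of
   these entries, while the closure would lie in a proper hypersurface of the span of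
   the axes and have local dimension less than s.  Smoothness excludes this in every
   chart containing X, and a pivot turns a path with three edges in the bipartite
   graph of nonzero entries of Y into such a square.  Hence the graph is a forest of
   stars: each star makes X, on its vertices, a line or a hyperplane with all
   coordinates nonzero, and the orbit closure is the product of the corresponding
   projective spaces. *)

Set Implicit Arguments.
Unset Strict Implicit.
Unset Printing Implicit Defensive.

Import Order.TTheory GRing.Theory Num.Theory.
Local Open Scope ring_scope.

(** In a chart the torus multiplies [Y i j] by [t j / t i]. Hence the cross ratio of a square of
    nonzero entries is invariant, and clearing its denominator gives the hypersurface. A path whose
    fourth entry is zero leaves no such trace, since its three entries scale independently; its
    singularity shows only in another chart, whence the pivot. Smoothness speaks of chains of
    irreducible closed sets, so what is needed is an upper bound on their length. It comes from the
    Krull dimension of a polynomial ring, bounded by a counting argument. Closed sets are cut out in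
    one chart and made global by adding the complement of that chart. One weight function [w]
    describes lines and hyperplanes alike: on each block it is a spanning vector or an equation. The
    torus rescales [w], so the orbit consists of the points with all weights nonzero, and its
    closure of those whose weights do not all vanish on any block. The weights are then homogeneous
    coordinates on a product of projective spaces. *)

Lemma mpoly_ring_ind (F : fieldType) n (P : {mpoly F[n]} -> Prop) :
  (forall c, P c%:MP) -> (forall i, P 'X_i) ->
  (forall p q, P p -> P q -> P (p + q)) ->
  (forall p q, P p -> P q -> P (p * q)) -> forall p, P p.
Proof.
move=> PC PX PD PM p; rewrite [p]mpolyE.
elim/big_ind: _ => [|//|m _]; first by rewrite -mpolyC0.
rewrite -mul_mpolyC; apply: (PM) => //; rewrite mpolyXE_id.
elim/big_ind: _ => [|//|i _]; first by rewrite -mpolyC1.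
elim: (m i) => [|k Pk]; first by rewrite expr0 -mpolyC1.
by rewrite exprS; apply: PM.
Qed.

(** * Polynomial functions and algebraic sets *)

Section Polyfun.
Variables (F : fieldType) (I : finType).
Implicit Types (x : affine F I) (f g : affine F I -> F).

(** Equations are written as functions of the point, so that determinants and sums over coordinates
    can be used without naming a polynomial. *)
Definition polyfun f := exists p : poly_on F I, forall x, f x = peval p x.

Lemma pevalC c x : peval c%:MP x = c. Proof. exact: mevalC. Qed.

Lemma pevalX i x : peval 'X_(enum_rank i) x = x i.
Proof. by rewrite /peval mevalXU enum_rankK. Qed.

Lemma pevalD p q x : peval (p + q) x = peval p x + peval q x.
Proof. exact: mevalD. Qed.

Lemma pevalN p x : peval (- p) x = - peval p x. Proof. exact: mevalN. Qed.

Lemma pevalM p q x : peval (p * q) x = peval p x * peval q x.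
Proof. exact: mevalM. Qed.

Lemma polyfunC c : polyfun (fun=> c).
Proof. by exists c%:MP => x; rewrite pevalC. Qed.

Lemma polyfunX i : polyfun (fun x => x i).
Proof. by exists 'X_(enum_rank i) => x; rewrite pevalX. Qed.

Lemma polyfunD f g : polyfun f -> polyfun g -> polyfun (fun x => f x + g x).
Proof. by move=> [p fp] [q gq]; exists (p + q) => x; rewrite pevalD fp gq. Qed.

Lemma polyfunM f g : polyfun f -> polyfun g -> polyfun (fun x => f x * g x).
Proof. by move=> [p fp] [q gq]; exists (p * q) => x; rewrite pevalM fp gq. Qed.

Lemma polyfunN f : polyfun f -> polyfun (fun x => - f x).
Proof. by move=> [p fp]; exists (- p) => x; rewrite pevalN fp. Qed.

Lemma polyfun_sum (K : Type) (s : seq K) (P : pred K) (f : K -> affine F I -> F) :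
  (forall k, polyfun (f k)) -> polyfun (fun x => \sum_(k <- s | P k) f k x).
Proof.
move=> pf; elim: s => [|k s [p sp]].
  by exists 0 => x; rewrite big_nil /peval meval0.
have [q fq] := pf k; exists (if P k then q + p else p) => x; rewrite big_cons.
by case: ifP => _; rewrite ?pevalD -?fq sp.
Qed.

Lemma polyfun_prod (K : Type) (s : seq K) (P : pred K) (f : K -> affine F I -> F) :
  (forall k, polyfun (f k)) -> polyfun (fun x => \prod_(k <- s | P k) f k x).
Proof.
move=> pf; elim: s => [|k s [p sp]].
  by exists 1%:MP => x; rewrite big_nil pevalC.
have [q fq] := pf k; exists (if P k then q * p else p) => x; rewrite big_cons.
by case: ifP => _; rewrite ?pevalM -?fq sp.
Qed.

Lemma polyfunXn f n : polyfun f -> polyfun (fun x => f x ^+ n).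
Proof.
move=> pf; elim: n => [|n [p fp]]; first exact: polyfunC.
by have [q fq] := pf; exists (q * p) => x; rewrite exprS pevalM -fq -fp.
Qed.

Lemma polyfun_det m (M : affine F I -> 'M[F]_m) :
  (forall i j, polyfun (fun x => M x i j)) -> polyfun (fun x => \det (M x)).
Proof.
move=> pM; apply: polyfun_sum => s; apply: polyfunM; first exact: polyfunC.
by apply: polyfun_prod => i.
Qed.

Lemma algebraic_polyfun (K : Type) (f : K -> affine F I -> F) (Q : K -> Prop) :
  (forall k, Q k -> polyfun (f k)) ->
  algebraic_set [set x | forall k, Q k -> f k x = 0]%classic.
Proof.
move=> pf; exists [set p | exists k, Q k /\ forall x, f k x = peval p x]%classic.
apply/seteqP; split=> x /= fx.
  by move=> p [k [Qk fE]]; rewrite -fE fx.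
by move=> k Qk; have [p fE] := pf k Qk; rewrite fE; apply: fx; exists k.
Qed.

Lemma algebraic_set0 : algebraic_set (set0 : set (affine F I)).
Proof.
rewrite (_ : set0 = [set x | forall k : unit, True -> (fun=> 1 : F) x = 0]%classic).
  by apply: algebraic_polyfun => _ _; apply: polyfunC.
apply/seteqP; split=> x //= /(_ tt Logic.I) /eqP; by rewrite oner_eq0.
Qed.

Lemma algebraic_vanishing Z x : algebraic_set Z ->
  (forall p : poly_on F I, vanishing_ideal Z p -> peval p x = 0) -> Z x.
Proof. by move=> [S ->] Zx p Sp; apply: Zx => y; apply. Qed.

End Polyfun.

(** This carries equations through a change of charts, whose components are fractions with a common
    denominator. *)
Lemma polyfun_clear_denominators (F : fieldType) (I : finType) (D : affine F I -> F) (K : finType)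
    (num : K -> affine F I -> F) (p : poly_on F K) :
  polyfun D -> (forall k, polyfun (num k)) ->
  exists N h, polyfun h /\ forall x, D x != 0 ->
    peval p [ffun k => num k x / D x] * D x ^+ N = h x.
Proof.
move=> pD pnum; elim/mpoly_ring_ind: p => [c|i|p q|p q].
- exists 0%N, (fun=> c); split=> [|x _]; first exact: polyfunC.
  by rewrite pevalC expr0 mulr1.
- exists 1%N, (num (enum_val i)); split=> // x Dx.
  by rewrite /peval mevalXU ffunE expr1 mulfVK.
- move=> [N [f [pf fE]]] [M [g [pg gE]]].
  exists (N + M)%N, (fun x => f x * D x ^+ M + g x * D x ^+ N); split.
    by apply: polyfunD; apply: polyfunM => //; apply: polyfunXn.
  by move=> x Dx; rewrite pevalD mulrDl -(fE x Dx) -(gE x Dx) exprD mulrA -!mulrA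
     [D x ^+ M * _]mulrC.
move=> [N [f [pf fE]]] [M [g [pg gE]]].
exists (N + M)%N, (fun x => f x * g x); split; first exact: polyfunM.
by move=> x Dx; rewrite pevalM -(fE x Dx) -(gE x Dx) exprD mulrACA.
Qed.

(** * Limits along polynomial curves and tangent directions *)

Lemma exists_nonroot (F : numFieldType) (r : {poly F}) : r != 0 -> exists u, r.[u] != 0.
Proof.
move=> r0; apply: contrapT => nr.
(* In characteristic 0 these are [size r] distinct elements, one more than the number of roots
   allows. *)
set rs := [seq n%:R : F | n <- iota 0 (size r)].
have: (size rs < size r)%N.
  apply: max_poly_roots r0 _ _.
    by apply/allP => u _; apply/negP => /negP ru; apply: nr; exists u.
  by rewrite map_inj_uniq ?iota_uniq // => i j /eqP; rewrite eqr_nat => /eqP.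
by rewrite size_map size_iota ltnn.
Qed.

Lemma poly_eq0_off (F : numFieldType) (r P : {poly F}) :
  r != 0 -> (forall u, r.[u] != 0 -> P.[u] = 0) -> P = 0.
Proof.
move=> r0 P0; apply/eqP/negP => /negP Pn0.
have [u] := exists_nonroot (mulf_neq0 r0 Pn0).
rewrite hornerM mulf_eq0 negb_or => /andP[ru]; by rewrite P0 // eqxx.
Qed.

Lemma curve_poly (F : fieldType) (I : finType) (q : I -> {poly F})
    (p : poly_on F I) :
  exists P : {poly F}, forall u, P.[u] = peval p [ffun i => (q i).[u]].
Proof.
elim/mpoly_ring_ind: p => [c|i|p1 p2 [P1 E1] [P2 E2]|p1 p2 [P1 E1] [P2 E2]].
- by exists c%:P => u; rewrite hornerC pevalC.
- by exists (q (enum_val i)) => u; rewrite /peval mevalXU ffunE.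
- by exists (P1 + P2) => u; rewrite hornerD pevalD E1 E2.
- by exists (P1 * P2) => u; rewrite hornerM pevalM E1 E2.
Qed.

(** Each equation of [Z], restricted to the curve, is a polynomial in [u] that vanishes off the
    roots of [r], hence identically. This takes the place of topological limits. *)
Lemma curve_limit (F : numFieldType) (I : finType) (Z : set (affine F I))
    (q : I -> {poly F}) (r : {poly F}) (u0 : F) : algebraic_set Z -> r != 0 ->
  (forall u, r.[u] != 0 -> Z [ffun i => (q i).[u]]) -> Z [ffun i => (q i).[u0]].
Proof.
move=> algZ r0 Zq; apply: algebraic_vanishing => // p Zp.
have [P PE] := curve_poly q p; rewrite -PE.
have -> : P = 0; last by rewrite horner0.
by apply: poly_eq0_off r0 _ => u ru; rewrite PE; apply: Zp; apply: Zq.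
Qed.

Lemma peval_taylor (F : fieldType) (I : finType) (x v : affine F I) (p : poly_on F I) :
  exists P : {poly F}, forall u,
    peval p (x + u *: v) = peval p x + u * differential p x v + u ^+ 2 * P.[u].
Proof.
have dD p1 p2 : differential (p1 + p2) x v = differential p1 x v + differential p2 x v.
  rewrite /differential -big_split; apply: eq_bigr => a _ /=.
  by rewrite mderivD pevalD mulrDl.
have dM p1 p2 : differential (p1 * p2) x v =
    peval p2 x * differential p1 x v + peval p1 x * differential p2 x v.
  rewrite /differential !mulr_sumr -big_split; apply: eq_bigr => a _ /=.
  by rewrite mderivM pevalD !pevalM; ring.
elim/mpoly_ring_ind: p => [c|i|p1 p2 [P1 E1] [P2 E2]|p1 p2 [P1 E1] [P2 E2]].
- exists 0 => u; rewrite !pevalC horner0 mulr0 addr0 /differential big1 ?mulr0 ?addr0 //.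
  by move=> a _; rewrite mderivC /peval meval0 mul0r.
- exists 0 => u; rewrite /peval !mevalXU horner0 mulr0 addr0 !ffunE.
  rewrite /differential (bigD1 i) //= big1 => [|a ai].
    rewrite mderivX mnm1E eqxx -[X in (X - _)%MM]add0m addmK scale1r.
    by rewrite mpolyX0 /peval meval1 mul1r addr0.
  by rewrite mderivX mnm1E eq_sym (negPf ai) scale0r /peval meval0 mul0r.
- by exists (P1 + P2) => u; rewrite !pevalD E1 E2 dD hornerD; ring.
- exists (peval p1 x *: P2 + peval p2 x *: P1 +
   (differential p1 x v)%:P * (differential p2 x v)%:P +
   'X * ((differential p1 x v) *: P2 + (differential p2 x v) *: P1) + 'X^2 * (P1 * P2)) => u.
  rewrite !pevalM E1 E2 dM !hornerE /=; ring.
Qed.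

Lemma differential_line (F : numFieldType) (I : finType) (x v : affine F I)
    (p : poly_on F I) :
  (forall u, peval p (x + u *: v) = 0) -> differential p x v = 0.
Proof.
move=> p0; have [P PE] := peval_taylor x v p.
have px : peval p x = 0 by rewrite -(p0 0) scale0r addr0.
have: (differential p x v)%:P + 'X * P = 0.
  apply: (@poly_eq0_off _ 'X); first by rewrite polyX_eq0.
  move=> u; rewrite !hornerE => u0.
  apply: (mulfI u0); rewrite mulr0 -(p0 u) PE px; ring.
by move/(congr1 (horner^~ 0)); rewrite !hornerE.
Qed.

(** * Chains of prime ideals in a polynomial ring *)

Section Krull.
Variables (F : fieldType) (m : nat).
Local Notation R := {mpoly F[m]}.
Implicit Types (P : R -> Prop) (p q x : R).

Definition prime_ideal P :=
  [/\ P 0 /\ (forall p q, P p -> P q -> P (p + q)), forall p q, P q -> P (p * q),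
      ~ P 1 & forall p q, P (p * q) -> P p \/ P q].

(** Linear independence over [F] of the images in the quotient by [P]. *)
Definition independent_mod P (B : finType) (f : B -> R) :=
  forall c : B -> F, P (\sum_b c b *: f b) -> forall b, c b = 0.

Lemma prime_idealXn P x n g : prime_ideal P -> ~ P x -> P (x ^+ n * g) -> P g.
Proof.
move=> [_ _ _ pP] nPx; elim: n => [|n IH]; first by rewrite expr0 mul1r.
by rewrite exprS -mulrA => /pP[|/IH].
Qed.

(** In a relation modulo [P], the lowest power of [x] cancels because [P] is prime and misses [x].
    Modulo [P'] the higher powers then disappear, which leaves a relation between the [f b]. *)
Lemma independent_mod_powers P P' x N (B : finType) (f : B -> R) :
  prime_ideal P -> prime_ideal P' -> (forall p, P p -> P' p) -> P' x -> ~ P x ->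
  independent_mod P' f ->
  independent_mod P (fun jb : 'I_N * B => x ^+ jb.1 * f jb.2).
Proof.
move=> primeP primeP' PP' P'x nPx indf c.
pose g (j : 'I_N) := \sum_b c (j, b) *: f b.
have -> : \sum_jb c jb *: (x ^+ jb.1 * f jb.2) = \sum_j x ^+ (j : 'I_N) * g j.
  rewrite (eq_bigr (fun jb => c (jb.1, jb.2) *: (x ^+ jb.1 * f jb.2))); last first.
    by case.
  rewrite -(pair_bigA _ (fun j b => c (j, b) *: (x ^+ (j : 'I_N) * f b))) /=.
  apply: eq_bigr => j _; rewrite mulr_sumr; apply: eq_bigr => b _.
  by rewrite -scalerAr.
move=> Pg [j b]; move: b.
have [n] := ubnP j; elim: n => // n IH in j *; rewrite ltnS => jn.
have g0 (i : 'I_N) : (i < j)%N -> g i = 0.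
  by move=> ij; rewrite /g big1 // => b _; rewrite IH ?scale0r // (leq_trans ij).
(* The terms above [j] divided by [x ^+ j.+1]; one factor [x] is kept outside to see that they lie
   in [P']. *)
pose r := \sum_(i < N | i != j) (if (j < i)%N then x ^+ (i - j).-1 * g i else 0).
have sE : \sum_j x ^+ (j : 'I_N) * g j = x ^+ j * (g j + r * x).
  rewrite (bigD1 j) //= mulrDr; congr (_ + _); rewrite mulr_suml mulr_sumr.
  apply: eq_bigr => i ij; case: (ltngtP i j) => [lij|lji|eij].
  - by rewrite g0 // mul0r !mulr0.
  - rewrite mulrAC -exprSr prednK ?subn_gt0 // mulrA -exprD subnKC //; exact: ltnW.
  - by move: ij; rewrite (val_inj eij) eqxx.
move: Pg; rewrite sE => /(prime_idealXn primeP nPx) /PP' Pg; apply: indf.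
have [[_ addP'] mulP' _ _] := primeP'.
rewrite -/(g j) -[g j](addrK (r * x)) -mulNr; apply: addP' => //.
exact: mulP'.
Qed.

(** Each step of the chain multiplies the number of polynomials by [N] and raises the degree by a
    multiple of [N]; the point is that [D] does not depend on [N]. *)
Lemma prime_chain_independent (W : nat -> R -> Prop) d :
  (forall i, (i <= d)%N -> prime_ideal (W i)) ->
  (forall i, (i < d)%N -> (forall p, W i p -> W i.+1 p) /\
                          exists x, W i.+1 x /\ ~ W i x) ->
  exists D, forall N, exists (B : finType) (f : B -> R),
    [/\ #|B| = (N ^ d)%N, forall b, (msize (f b) <= (D * N).+1)%N
      & independent_mod (W 0%N) f].
Proof.
elim: d W => [|d IH] W primeW chainW.
  exists 0%N => N; exists unit, (fun=> 1); split; rewrite ?card_unit //.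
    by move=> _; rewrite msize1.
  have [_ mulW W1 _] := primeW 0%N isT.
  move=> c; rewrite (bigD1 tt) //= big1 ?addr0 => [Wc []|[] //].
  apply/eqP/negP => /negP c0; apply: W1.
  have := mulW (c tt)^-1%:MP _ Wc.
  by rewrite mul_mpolyC scalerA mulVf // scale1r.
have [D HD] := IH (fun i => W i.+1) (fun i => primeW i.+1) (fun i => chainW i.+1).
have [W01 [x [W1x W0x]]] := chainW 0%N isT.
exists (msize x + D)%N => N; have [B [f [cardB sizef indf]]] := HD N.
exists ('I_N * B)%type, (fun jb : 'I_N * B => x ^+ jb.1 * f jb.2); split.
- by rewrite card_prod card_ord cardB expnS.
- have sizeM p q : (msize (p * q) <= (msize p + msize q).-1)%N.
    have [->|p0] := eqVneq p 0; first by rewrite mul0r msize0.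
    have [->|q0] := eqVneq q 0; first by rewrite mulr0 msize0.
    by rewrite msizeM.
  have sizeX j : (msize (x ^+ j) <= (j * msize x).+1)%N.
    elim: j => [|j IHj]; first by rewrite expr0 msize1.
    by rewrite exprS; apply: leq_trans (sizeM _ _) _; rewrite mulSn; lia.
  move=> [j b] /=; apply: leq_trans (sizeM _ _) _.
  have := sizeX j; have := sizef b; have := ltn_ord j; move: (msize x) => s.
  nia.
- by apply: independent_mod_powers indf => //; apply: primeW.
Qed.

Lemma independent_card (B : finType) (f : B -> R) D :
  (forall b, (msize (f b) <= D.+1)%N) -> independent_mod (eq^~ 0) f ->
  (#|B| <= D.+1 ^ m)%N.
Proof.
move=> sizef indf; rewrite leqNgt; apply/negP => ltB.
(* Monomials with every exponent at most [D]: a box containing all those of degree at most [D], and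
   easier to count. More polynomials than monomials give a vector in the left kernel of the
   coefficient matrix. *)
pose M := {ffun 'I_m -> 'I_D.+1}.
have cardM : #|M| = (D.+1 ^ m)%N by rewrite card_ffun !card_ord.
pose A := \matrix_(i < #|B|, j < #|M|)
  (f (enum_val i))@_[multinom (enum_val j k : nat) | k < m].
have /rowV0Pn[u] : kermx A != 0.
  rewrite -mxrank_eq0 mxrank_ker subn_eq0 -ltnNge.
  by apply: leq_ltn_trans (rank_leq_col _) _; rewrite cardM.
move/sub_kermxP => uA0 /rV0Pn[i ui].
have fb0 : \sum_b u 0 (enum_rank b) *: f b = 0.
  apply/mpolyP => mm; rewrite mcoeff0 raddf_sum /=.
  have [mmD|Dmm] := leqP (mdeg mm) D.
    have mmk k : (mm k < D.+1)%N.
      by rewrite ltnS; apply: leq_trans mmD; rewrite mdegE (bigD1 k) //= leq_addr.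
    pose j := enum_rank [ffun k => Ordinal (mmk k)].
    have := congr1 (fun v : 'rV_ _ => v 0 j) uA0; rewrite !mxE => uAj.
    rewrite -[RHS]uAj.
    rewrite (reindex (@enum_rank B)) /=; last by apply: onW_bij; apply: enum_rank_bij.
    apply: eq_bigr => b _; rewrite mcoeffZ /A mxE.
    congr (_ * mcoeff _ _); last by rewrite enum_rankK.
    by apply/mnmP => k; rewrite mnmE /j enum_rankK ffunE.
  rewrite big1 // => b _; rewrite mcoeffZ memN_msupp_eq0 ?mulr0 //.
  by apply: msize_mdeg_ge; apply: leq_trans (sizef b) _.
by move: ui; rewrite -(enum_valK i) (indf _ fb0) eqxx.
Qed.

(* A chain of length [d] gives, for each [N], [N ^ d] independent polynomials of
   degree [O(N)], while these span a space of dimension [O(N ^ m)]. *)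
Lemma prime_chain_length (W : nat -> R -> Prop) d : (forall p, W 0%N p -> p = 0) ->
  (forall i, (i <= d)%N -> prime_ideal (W i)) ->
  (forall i, (i < d)%N -> (forall p, W i p -> W i.+1 p) /\
                          exists x, W i.+1 x /\ ~ W i x) ->
  (d <= m)%N.
Proof.
move=> W0 primeW chainW; rewrite leqNgt; apply/negP => md.
have [D HD] := prime_chain_independent primeW chainW.
(* Comparing [N ^ m.+1] with [(D.+1 * N) ^ m] would give [N <= D.+1 ^ m], which this value of [N]
   violates. *)
pose N := (D.+1 ^ m).+1; have [B [f [cardB sizef indf]]] := HD N.
have [[Wz _] _ _ _] := primeW 0%N isT.
have indf0 : independent_mod (eq^~ 0) f by move=> c c0; apply: indf; rewrite c0.
have := independent_card sizef indf0; rewrite cardB.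
have N0 : (0 < N)%N by [].
move=> le1; have : (N ^ m.+1 <= (D.+1 * N) ^ m)%N.
  apply: leq_trans (leq_trans _ le1) _; first by rewrite leq_pexp2l.
  have le_exp2r a b e : (a <= b -> a ^ e <= b ^ e)%N.
    by move=> ab; elim: e => // e IHe; rewrite !expnS leq_mul.
  by apply: le_exp2r; nia.
by rewrite expnS expnMn leq_pmul2r ?expn_gt0 ?N0 // ltnn.
Qed.

End Krull.

(** * Standard charts of the Grassmannian *)

Section Charts.
Variables (F : fieldType) (J : finType) (k : nat).
Implicit Types (c : Gr_index J k) (Y : J -> J -> F) (v : affine F J) (V : Gr F J k).

(** A chart matrix is given by a function on all pairs of coordinates, of which only the entries
    with row in [c] and column outside [c] count; this avoids subtypes as indices. *)
Definition coords c Y : affine F (Gr_coord c) :=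
  [ffun p => Y (val p.1) (val p.2)].

Definition gchart c Y : Gr F J k := chart (M := Gr F J k) c (coords c Y).

Lemma extend0_val (P : pred J) (u : affine F {j | P j}) (i : {j | P j}) :
  extend0 u (val i) = u i.
Proof. by rewrite ffunE valK. Qed.

Lemma extend0_out (P : pred J) (u : affine F {j | P j}) l :
  ~~ P l -> extend0 u l = 0.
Proof. by move=> Pl; rewrite ffunE insubN. Qed.

Lemma Gr_eq (V W : Gr F J k) :
  (forall v, v \in val V <-> v \in val W) -> V = W.
Proof.
move=> VW; apply/val_inj/vspaceP => v; apply/idP/idP; by move/VW.
Qed.

Lemma mem_chart c (A : affine F (Gr_coord c)) v :
  v \in val (chart (M := Gr F J k) c A) <->
  forall j : {j | j \notin val c},
    v (val j) = \sum_(i : {i | i \in val c}) v (val i) * A (i, j).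
Proof.
split=> [/memv_imgP[u _ ->] j|vE].
  rewrite lfunE /graph_map ffunE extend0_out ?add0r; last exact: (valP j).
  rewrite extend0_val ffunE; apply: eq_bigr => i _; rewrite ffunE extend0_val.
  by rewrite extend0_out ?addr0 // negbK (valP i).
apply/memv_imgP; exists [ffun i => v (val i)]; first exact: memvf.
apply/ffunP => l; rewrite lfunE /graph_map ffunE.
have [lc|lc] := boolP (l \in val c).
  rewrite -[l]/(val (exist (fun l => l \in val c) l lc)) extend0_val ffunE.
  by rewrite extend0_out ?addr0 // negbK.
rewrite [X in X + _]extend0_out // add0r.
rewrite -[l]/(val (exist (fun l => l \notin val c) l lc)) extend0_val ffunE vE.
by apply: eq_bigr => i _; rewrite ffunE.
Qed.

Lemma mem_gchart c Y v : v \in val (gchart c Y) <->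
  forall j, j \notin val c -> v j = \sum_(i in val c) v i * Y i j.
Proof.
rewrite mem_chart; split=> vE j.
  move=> jc; rewrite (vE (exist _ j jc)) [RHS]big_sub.
  by apply: eq_bigr => i _; rewrite ffunE.
rewrite vE ?(valP j) // big_sub.
by apply: eq_bigr => i _; rewrite ffunE.
Qed.

Lemma coords_surj c (A : affine F (Gr_coord c)) : exists Y, A = coords c Y.
Proof.
exists (fun i j => if (insub i, insub j) is (Some i', Some j') then A (i', j') else 0).
by apply/ffunP => -[i j]; rewrite ffunE /= !valK.
Qed.

(** For [u] the indicator of a row index this is a row of the matrix (identity | [Y]), a basis
    vector of the graph. *)
Definition graph_vec c Y (u : J -> F) : affine F J :=
  [ffun l => if l \in val c then u l else \sum_(i in val c) u i * Y i l].

Lemma mem_graph_vec c Y u : graph_vec c Y u \in val (gchart c Y).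
Proof.
apply/mem_gchart => j jc; rewrite ffunE (negPf jc).
by apply: eq_bigr => i ic; rewrite ffunE ic.
Qed.

Lemma gchart_eq0 c Y v : v \in val (gchart c Y) ->
  (forall i, i \in val c -> v i = 0) -> v = 0.
Proof.
move=> /mem_gchart vE v0; apply/ffunP => l; rewrite ffunE.
have [/v0 //|/vE ->] := boolP (l \in val c).
by rewrite big1 // => i /v0 ->; rewrite mul0r.
Qed.

Lemma graph_vec_delta c Y (i j : J) : i \in val c -> j \notin val c ->
  graph_vec c Y (fun l => (l == i)%:R) j = Y i j.
Proof.
move=> ic jc; rewrite ffunE (negPf jc) (bigD1 i) //= eqxx mul1r.
by rewrite big1 ?addr0 // => l /andP[_ /negPf ->]; rewrite mul0r.
Qed.

Lemma gchart_inj c Y Y' : gchart c Y = gchart c Y' ->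
  forall i j, i \in val c -> j \notin val c -> Y i j = Y' i j.
Proof.
move=> YY' i j ic jc.
have := mem_graph_vec c Y (fun l => (l == i)%:R); rewrite YY'.
move/mem_gchart/(_ j jc); rewrite graph_vec_delta // => ->.
rewrite (bigD1 i) //= ffunE ic eqxx mul1r big1 ?addr0 // => l /andP[lc li].
by rewrite ffunE lc (negPf li) mul0r.
Qed.

Lemma eq_gchart c Y Y' :
  (forall i j, i \in val c -> j \notin val c -> Y i j = Y' i j) ->
  gchart c Y = gchart c Y'.
Proof.
move=> YY'; congr chart; apply/ffunP => -[i j].
by rewrite !ffunE; apply: YY'; [apply: (valP i) | apply: (valP j)].
Qed.

Lemma gchart_eqP c Y V :
  (forall v, v \in val V -> forall j, j \notin val c ->
     v j = \sum_(i in val c) v i * Y i j) -> V = gchart c Y.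
Proof.
move=> VY; apply/val_inj/eqP; rewrite eqEdim (eqP (valP V)) (eqP (valP (gchart c Y))).
by rewrite leqnn andbT; apply/subvP => v /VY vE; apply/mem_gchart.
Qed.

End Charts.

(* A subset [I] of the coordinates, minimal such that a vector of [V] is
   determined by its coordinates in [I], gives a chart around [V]. *)
Lemma gchart_surj (F : fieldType) (J : finType) k (V : Gr F J k) :
  exists (c : Gr_index J k) Y, V = gchart c Y.
Proof.
pose det (I : {set J}) := `[< forall v, v \in val V ->
  (forall i, i \in I -> v i = 0) -> v = 0 >].
have detT : det [set: J].
  by apply/asboolP => v _ v0; apply/ffunP => l; rewrite v0 ?inE // ffunE.
have [I /minsetP[/asboolP detI minI] _] := minset_exists detT.
(* By minimality some nonzero vector of [V] vanishes on [I] minus [i]. Normalised at [i], these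
   vectors form the basis dual to the coordinates in [I]. *)
have vec i : exists v, i \in I -> [/\ v \in val V, v i = 1 &
    forall l, l \in I -> l != i -> v l = 0].
  have [iI|iI] := boolP (i \in I); last by exists 0.
  have /asboolPn : ~~ det (I :\ i).
    apply/negP => /(minI _) /(_ (subD1set _ _)) /setP/(_ i).
    by rewrite iI !inE eqxx.
  move/existsNP=> [v /not_implyP[vV /not_implyP[v0 vn0]]].
  have vi : v i != 0.
    apply/eqP => vi0; apply: vn0; apply: detI => // l lI.
    by have [->//|li] := eqVneq l i; apply: v0; rewrite !inE li.
  exists ((v i)^-1 *: v) => _; split; first exact: memvZ.
    by rewrite ffunE [_ *: _]mulVf.
  move=> l lI li; rewrite ffunE (_ : v l = 0) ?scaler0 //.
  by apply: v0; rewrite !inE li.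
have {vec}[e eE] := choice vec.
have cardI : #|I| == #|I| by [].
pose Y (i j : J) : F := e i j.
(* The equality of [#|I|] and [k] is known only once the graph is identified with [V], so the chart
   is first taken in dimension [#|I|]. *)
pose cI : Gr_index J #|I| := exist _ I cardI.
have VE v : v \in val V <-> v \in val (gchart cI Y).
  have eV u : \sum_(i in I) u i *: e i \in val V.
    by apply: memv_suml => i /eE[ei _ _]; apply: memvZ.
  have eI (u : J -> F) l : l \in I -> (\sum_(i in I) u i *: e i) l = u l.
    move=> lI; rewrite sum_ffunE (bigD1 l) //= ffunE; have [_ -> _] := eE l lI.
    rewrite big1 ?addr0 => [|i /andP[iI il]]; first exact: mulr1.
    by rewrite ffunE; have [_ _ ->] := eE i iI; rewrite ?scaler0 // eq_sym.
  have sumE (u : J -> F) j : (\sum_(i in I) u i *: e i) j = \sum_(i in I) u i * e i j.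
    by rewrite sum_ffunE; apply: eq_bigr => i _; rewrite ffunE.
  split=> [vV|/mem_gchart /= vE].
    have v0 : v - \sum_(i in I) v i *: e i = 0.
      apply: detI; first by apply: rpredB.
      by move=> i iI; rewrite !ffunE eI ?subrr.
    apply/mem_gchart => j _; rewrite -sumE.
    by move/eqP: v0; rewrite subr_eq0 => /eqP {1}->.
  rewrite (_ : v = \sum_(i in I) v i *: e i) //; apply/ffunP => l.
  have [lI|lI] := boolP (l \in I); first by rewrite eI.
  by rewrite vE // sumE.
have kI : k = #|I|.
  rewrite -(eqP (valP V)) -(eqP (valP (gchart cI Y))).
  have VW : val V = val (gchart cI Y).
    by apply/vspaceP => v; apply/idP/idP => /VE.
  by rewrite VW.
move: (V) VE; rewrite kI => V' VE.
by exists cI, Y; apply: Gr_eq.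
Qed.

(** * Change of charts, and closed sets given by equations in one chart *)

Section ExtendFromChart.
Variables (F : fieldType) (J : finType) (k : nat).
Implicit Types (c : Gr_index J k) (v : affine F J) (V : Gr F J k).

Definition nth_index c (a : 'I_k) : J :=
  enum_val (cast_ord (esym (eqP (valP c))) a).

Lemma nth_indexP c a : nth_index c a \in val c.
Proof. exact: enum_valP. Qed.

Lemma nth_index_inj c : injective (nth_index c).
Proof. by move=> a b /enum_val_inj /cast_ord_inj. Qed.

Lemma nth_index_surj c i : i \in val c -> exists a, nth_index c a = i.
Proof.
move=> ic; exists (cast_ord (eqP (valP c)) (enum_rank_in ic i)).
by rewrite /nth_index cast_ordK enum_rankK_in.
Qed.

Lemma big_nth_index c (G : J -> F) :
  \sum_(i in val c) G i = \sum_a G (nth_index c a).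
Proof.
rewrite big_enum_val (reindex (cast_ord (esym (eqP (valP c))))) //=.
apply: onW_bij; exists (cast_ord (eqP (valP c))); first exact: cast_ordKV.
exact: cast_ordK.
Qed.

Lemma chart_eq c (A : affine F (Gr_coord c)) V :
  (forall v, v \in val V -> forall j : {j | j \notin val c},
    v (val j) = \sum_(i : {i | i \in val c}) v (val i) * A (i, j)) ->
  V = chart (M := Gr F J k) c A.
Proof.
move=> VA; apply/val_inj/eqP.
rewrite eqEdim (eqP (valP V)) (eqP (valP (chart (M := Gr F J k) c A))).
by rewrite leqnn andbT; apply/subvP => v /VA vE; apply/mem_chart.
Qed.

Lemma chart_inj c : injective (chart (M := Gr F J k) c).
Proof.
move=> A A'; have [Y ->] := coords_surj A; have [Y' ->] := coords_surj A'.
move=> /gchart_inj YY'; apply/ffunP => -[i j]; rewrite !ffunE.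
by apply: YY'; [apply: (valP i) | apply: (valP j)].
Qed.

Variables c c' : Gr_index J k.
Implicit Types (y : affine F (Gr_coord c')).

(** Row [a] of the matrix (identity | [y]) whose rows span the point with coordinates [y] in the
    chart [c']. *)
Definition graph_row y (a : 'I_k) (l : J) : F :=
  if insub l is Some j then y (exist _ (nth_index c' a) (nth_indexP c' a), j)
  else (l == nth_index c' a)%:R.

Definition graph_rows y (l : J) : 'cV[F]_k := \col_a graph_row y a l.
Definition graph_minor y : 'M[F]_k := \matrix_(a, b) graph_row y a (nth_index c b).
(** Cramer's rule for the inverse of the minor on the columns [c], applied to a column outside [c].
    The outer sum has one term: it finds the position of [ij.1] in [c]. *)
Definition transition_num (ij : Gr_coord c) y : F :=
  \sum_(b | nth_index c b == val ij.1)
    \sum_a (\adj (graph_minor y)) b a * graph_row y a (val ij.2).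
Definition transition y : affine F (Gr_coord c) :=
  [ffun ij => transition_num ij y / \det (graph_minor y)].

Lemma polyfun_graph_row a l : polyfun (fun y => graph_row y a l).
Proof.
by rewrite /graph_row; case: insub => [j|]; [apply: polyfunX | apply: polyfunC].
Qed.

Lemma polyfun_minor : polyfun (fun y => \det (graph_minor y)).
Proof.
apply: polyfun_det => a b; have [p pE] := polyfun_graph_row a (nth_index c b).
by exists p => y; rewrite mxE.
Qed.

Lemma polyfun_transition_num ij : polyfun (transition_num ij).
Proof.
apply: polyfun_sum => b; apply: polyfun_sum => a.
apply: polyfunM; last exact: polyfun_graph_row.
suff [p pE] : polyfun (fun y => cofactor (graph_minor y) a b).
  by exists p => y; rewrite mxE.
apply: polyfunM; first exact: polyfunC.
apply: polyfun_det => i j.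
have [p pE] := polyfun_graph_row (lift a i) (nth_index c (lift b j)).
by exists p => y; rewrite !mxE.
Qed.

Lemma mem_chart_rows y v : v \in val (chart (M := Gr F J k) c' y) ->
  forall l, v l = ((\row_a v (nth_index c' a)) *m graph_rows y l) 0 0.
Proof.
move=> /mem_chart vE l; rewrite mxE.
have [lc|lc] := boolP (l \in val c').
  have [a al] := nth_index_surj lc; rewrite (bigD1 a) //= !mxE /graph_row.
  rewrite insubF ?lc // -al eqxx mulr1 big1 ?addr0 // => b ba.
  rewrite !mxE /graph_row insubF ?nth_indexP //.
  by rewrite (inj_eq (@nth_index_inj c')) eq_sym (negPf ba) mulr0.
rewrite -[l]/(val (exist (fun l => l \notin val c') l lc)) vE.
pose G i := if insub i is Some i' then v i * y (i', exist (fun l => l \notin val c') l lc) else 0.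
transitivity (\sum_(i in val c') G i).
  by rewrite [RHS]big_sub; apply: eq_bigr => i _; rewrite /G valK.
rewrite big_nth_index; apply: eq_bigr => a _; rewrite !mxE /graph_row /G.
by rewrite !insubT ?nth_indexP // => h; congr (_ * y (_, _)); apply: val_inj.
Qed.

Lemma chart_transition y : \det (graph_minor y) != 0 ->
  chart (M := Gr F J k) c' y = chart (M := Gr F J k) c (transition y).
Proof.
move=> D0; apply: chart_eq => v /mem_chart_rows vE j.
set u := \row_a v (nth_index c' a) in vE.
have vc b : v (nth_index c b) = (u *m graph_minor y) 0 b.
  by rewrite vE !mxE; apply: eq_bigr => a _; rewrite !mxE.
pose G i := if insub i is Some i' then v i * transition y (i', j) else 0.
rewrite vE; transitivity (\sum_(i in val c) G i); last first.
  by rewrite [LHS]big_sub; apply: eq_bigr => i _; rewrite /G valK.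
have uE : u = (\det (graph_minor y))^-1 *: (u *m graph_minor y *m \adj (graph_minor y)).
  by rewrite -mulmxA mul_mx_adj mul_mx_scalar scalerA mulVf ?scale1r.
rewrite {1}uE -scalemxAl -mulmxA mxE [X in _ * X]mxE mulr_sumr big_nth_index.
apply: eq_bigr => b _; rewrite /G insubT ?nth_indexP // => h.
rewrite vc ffunE /transition_num /= mulrCA; congr (_ * _).
rewrite mulrC; congr (_ / _); rewrite (big_pred1 b) => [|b' /=].
  by rewrite [LHS]mxE; apply: eq_bigr => a _; rewrite [graph_rows _ _ _ _]mxE.
by rewrite (inj_eq (@nth_index_inj c)).
Qed.

(** The basis vectors of the graph over [c] are combinations of the rows over [c']; their
    coefficients form a left inverse of the minor. *)
Lemma minor_neq0 y A :
  chart (M := Gr F J k) c' y = chart (M := Gr F J k) c A ->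
  \det (graph_minor y) != 0.
Proof.
have [Y ->] := coords_surj A => yA.
pose s b := graph_vec c Y (fun l => (l == nth_index c b)%:R).
have sE b l : s b l = ((\row_a s b (nth_index c' a)) *m graph_rows y l) 0 0.
  by apply: mem_chart_rows; rewrite yA; apply: mem_graph_vec.
pose C := \matrix_(b, a) s b (nth_index c' a).
have CB : C *m graph_minor y = 1%:M.
  apply/matrixP => b b'; rewrite !mxE.
  transitivity (s b (nth_index c b')).
    by rewrite sE !mxE; apply: eq_bigr => a _; rewrite !mxE.
  by rewrite ffunE nth_indexP (inj_eq (@nth_index_inj c)) eq_sym.
by have /mulmx1_unit[_] := CB; rewrite unitmxE unitfE.
Qed.

End ExtendFromChart.

(** This set is the union of [P] and the complement of the chart [c]. In another chart its equations
    are those of [P] with denominators cleared, times the minor whose vanishing means being outside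
    the chart [c]. *)
Lemma zclosed_extend (F : fieldType) (J : finType) k (c : Gr_index J k)
    (P : set (affine F (Gr_coord c))) : algebraic_set P ->
  zclosed [set V : Gr F J k | forall A, V = chart (M := Gr F J k) c A -> P A]%classic.
Proof.
move=> [S ->] c'.
pose Q (h : affine F (Gr_coord c') -> F) := polyfun h /\ exists p, S p /\
  forall y, \det (graph_minor c y) != 0 -> exists N,
    peval p (transition c y) * \det (graph_minor c y) ^+ N = h y.
rewrite (_ : _ @^-1` _ = [set y | forall h, Q h ->
   h y * \det (graph_minor c y) = 0])%classic.
  by apply: algebraic_polyfun => h [ph _]; apply: polyfunM => //; apply: polyfun_minor.
apply/seteqP; split=> y /= yP.
  move=> h [_ [p [Sp hE]]]; have [->|D0] := eqVneq (\det (graph_minor c y)) 0.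
    by rewrite mulr0.
  have [N <-] := hE y D0.
  by rewrite (yP _ (chart_transition D0) _ Sp) !mul0r.
move=> A yA p Sp; have D0 := minor_neq0 yA.
have -> : A = transition c y by apply: chart_inj; apply: etrans (esym yA) (chart_transition D0).
have [N [h [ph hE]]] := polyfun_clear_denominators p
  (polyfun_minor F c c') (@polyfun_transition_num F J k c c').
have /yP/eqP : Q h by split=> //; exists p; split=> // z Dz; exists N; apply: hE.
by rewrite -hE // !mulf_eq0 (negPf (expf_neq0 _ D0)) (negPf D0) !orbF => /eqP.
Qed.

(** * Irreducible closed sets seen in a chart, and the length of their chains *)

Section ChartOfIrreducible.
Variables (F : fieldType) (J : finType) (k : nat) (c : Gr_index J k).
Local Notation chart := (chart (M := Gr F J k)).
Implicit Types (W : set (Gr F J k)) (f g : affine F (Gr_coord c) -> F).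

Lemma zclosed_polyfun f : polyfun f ->
  zclosed [set V : Gr F J k | forall A, V = chart c A -> f A = 0]%classic.
Proof.
move=> pf; rewrite (_ : [set _ | _] = [set V : Gr F J k | forall A, V = chart c A ->
  [set A | forall i : unit, True -> f A = 0]%classic A])%classic.
  by apply: zclosed_extend; apply: algebraic_polyfun.
apply/seteqP; split=> V /= VP A VA; first by move=> _ _; apply: VP.
by apply: (VP A VA tt).
Qed.

(** Primality of the ideal of [W] in the chart: the zero sets of [f] and of [g], each enlarged by
    the complement of the chart, are closed and cover [W]. *)
Lemma zirreducible_chartM W f g : zirreducible W -> polyfun f -> polyfun g ->
  (forall A, W (chart c A) -> f A * g A = 0) ->
  (forall A, W (chart c A) -> f A = 0) \/ (forall A, W (chart c A) -> g A = 0).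
Proof.
move=> [_ irrW] pf pg fg0.
have [V WV|WP|WP] := irrW _ _ (zclosed_polyfun pf) (zclosed_polyfun pg).
- have [[A VA]|nA] := EM (exists A, V = chart c A); last first.
    by left=> A VA; case: nA; exists A.
  move: WV; rewrite VA => /fg0/eqP; rewrite mulf_eq0 => /orP[]/eqP h0.
    by left=> A' /chart_inj <-.
  by right=> A' /chart_inj <-.
- by left=> A /WP; apply.
- by right=> A /WP; apply.
Qed.

(** Otherwise [W'] would be covered by [W] and the complement of the chart, the closed extension of
    the empty set; the point [A0] excludes the latter. *)
Lemma zirreducible_chart_proper W W' A0 : zclosed W -> zirreducible W' ->
  (W `<` W')%classic -> W' (chart c A0) -> exists A, W' (chart c A) /\ ~ W (chart c A).
Proof.
move=> closedW [_ irrW'] [WW' nWW'] W'0; apply: contrapT => nA.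
have [V W'V|/nWW'//|W'P] := irrW' _ _ closedW (zclosed_extend (algebraic_set0 F (Gr_coord c))).
- have [[A VA]|nVA] := EM (exists A, V = chart c A).
    by left; apply: contrapT => nWV; apply: nA; exists A; rewrite -VA.
  by right=> A VA; case: nVA; exists A.
- by case: (W'P _ W'0 A0).
Qed.

End ChartOfIrreducible.

Lemma restrict_variables (F : fieldType) (I : finType) (S : {set I}) (p : poly_on F I) :
  exists q : {mpoly F[#|S|]}, forall x : affine F I, (forall a, a \notin S -> x a = 0) ->
    q.@[fun s => x (enum_val s)] = peval p x.
Proof.
elim/mpoly_ring_ind: p => [c|i|p1 p2 [q1 E1] [q2 E2]|p1 p2 [q1 E1] [q2 E2]].
- by exists c%:MP => x _; rewrite mevalC pevalC.
- have [iS|iS] := boolP (enum_val i \in S).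
    exists 'X_(enum_rank_in iS (enum_val i)) => x _.
    by rewrite /peval !mevalXU enum_rankK_in.
  by exists 0 => x x0; rewrite meval0 /peval mevalXU x0.
- by exists (q1 + q2) => x x0; rewrite mevalD pevalD E1 // E2.
- by exists (q1 * q2) => x x0; rewrite mevalM pevalM E1 // E2.
Qed.

Lemma polyfun_restricted (F : fieldType) (I : finType) (S : {set I})
    (q : {mpoly F[#|S|]}) :
  polyfun (fun x : affine F I => q.@[fun s => x (enum_val s)]).
Proof.
elim/mpoly_ring_ind: q => [c|i|p1 p2 [q1 E1] [q2 E2]|p1 p2 [q1 E1] [q2 E2]].
- by exists c%:MP => x; rewrite mevalC pevalC.
- exists 'X_(enum_rank (enum_val i)) => x; by rewrite mevalXU pevalX.
- by exists (q1 + q2) => x; rewrite mevalD pevalD E1 // E2.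
- by exists (q1 * q2) => x; rewrite mevalM pevalM E1 // E2.
Qed.

(* The vanishing ideals of the members of the chain live in [#|S|] variables and all
   contain [b], so the chain of primes can be prolonged below by the zero ideal. *)
Lemma chain_length_hypersurface (F : fieldType) (J : finType) k (c : Gr_index J k)
    (Z : set (Gr F J k)) (S : {set Gr_coord c}) (b : poly_on F (Gr_coord c))
    (A0 x1 : affine F (Gr_coord c)) d :
  (forall A, Z (chart (M := Gr F J k) c A) -> forall a, a \notin S -> A a = 0) ->
  (forall A, Z (chart (M := Gr F J k) c A) -> peval b A = 0) ->
  (forall a, a \notin S -> x1 a = 0) -> peval b x1 != 0 ->
  irreducible_chain Z (chart (M := Gr F J k) c A0) d -> (d < #|S|)%N.
Proof.
set ch := chart (M := Gr F J k) c => ZS Zb x1S bx1 [W [WP WW]]; rewrite ltnNge; apply/negP => Sd.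
pose ev (q : {mpoly F[#|S|]}) (x : affine F (Gr_coord c)) : F :=
  q.@[fun s => x (enum_val s)].
have evM q q' x : ev (q * q') x = ev q x * ev q' x by exact: mevalM.
(* Larger sets have smaller ideals, so the order is reversed: the zero ideal, then the ideals of
   [W #|S|] down to [W 0]. This is a chain of length [#|S|.+1] in [#|S|] variables. *)
pose Q i (q : {mpoly F[#|S|]}) : Prop := if i is i'.+1 then
  forall A, W (#|S| - i')%N (ch A) -> ev q A = 0 else q = 0.
suff : (#|S|.+1 <= #|S|)%N by rewrite ltnn.
apply: (@prime_chain_length F #|S| Q) => // -[|i] /= iS.
- split=> //; first by split=> // p q -> ->; rewrite addr0.
  + by move=> p q ->; rewrite mulr0.
  + by apply/eqP; rewrite oner_eq0.
  + by move=> p q /eqP; rewrite mulf_eq0 => /orP[]/eqP; [left | right].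
- have [clW irrW W0 WZ] := WP (#|S| - i)%N (leq_trans (leq_subr _ _) Sd).
  split=> //=.
  + split=> [A _|p q p0 q0 A WA]; first exact: meval0.
    by rewrite /ev mevalD -/(ev p A) -/(ev q A) p0 // q0 // addr0.
  + by move=> p q q0 A WA; rewrite evM q0 // mulr0.
  + by move=> /(_ A0 W0)/eqP; rewrite /ev meval1 oner_eq0.
  + move=> p q pq0; apply: (zirreducible_chartM irrW).
    * exact: polyfun_restricted.
    * exact: polyfun_restricted.
    * by move=> A WA; rewrite -evM pq0.
- split=> [p -> A _|]; first exact: meval0.
  (* The first inclusion is strict because [b] stays nonzero, at [x1], after restriction to the
     coordinates in [S]. *)
  have [q qE] := restrict_variables S b; exists q; split=> [A WA|q0].
    have [_ _ _ WZ] := WP (#|S| - 0)%N (leq_trans (leq_subr _ _) Sd).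
    by rewrite /ev qE; [apply/Zb/WZ | apply/ZS/WZ].
  by move: bx1; rewrite -qE // q0 meval0 eqxx.
- have iS' : (#|S| - i = (#|S| - i.+1).+1)%N by rewrite subnSK.
  have iWd : (#|S| - i.+1 < d)%N by rewrite -iS'; apply: leq_trans (leq_subr _ _) Sd.
  have Wlt := WW _ iWd; have [clW _ _ _] := WP _ (ltnW iWd).
  rewrite iS'; have [_ irrW W0 WZ] := WP _ iWd.
  split=> [p p0 A WA|]; first by apply: p0; apply: Wlt.1.
  have [A [WA nWA]] := zirreducible_chart_proper clW irrW Wlt W0.
  have [p [pW pA]] : exists p : poly_on F (Gr_coord c),
      (forall B, W (#|S| - i.+1)%N (ch B) -> peval p B = 0) /\ peval p A <> 0.
    apply: contrapT => np; apply: nWA; apply: (algebraic_vanishing (clW c)) => p pW.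
    by apply: contrapT => pA; apply: np; exists p.
  have [q qE] := restrict_variables S p.
  exists q; split=> [B WB|/(_ A WA)]; rewrite /ev qE.
  + exact: pW.
  + by apply/ZS/WZ; apply: Wlt.1.
  + exact: pA.
  + exact/ZS/WZ.
Qed.

(** * The torus action in charts, and the exclusion of squares *)

Section Torus.
Variables (F : numFieldType) (n k : nat).
Implicit Types (X V : Gr F 'I_n k) (c : Gr_index 'I_n k) (t : 'I_n -> F).

Lemma torus_orbitP X V : torus_orbit X V <->
  exists t, (forall i, t i != 0) /\
    forall v, v \in val X <-> diag_act t v \in val V.
Proof.
split=> -[t [t0 VE]]; exists t; split=> //.
  move=> v; rewrite VE; split=> [vX|/memv_imgP[w wX]].
    by apply/memv_imgP; exists v; rewrite // lfunE.
  rewrite lfunE => /ffunP vw; rewrite (_ : v = w) //; apply/ffunP => l.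
  by have := vw l; rewrite !ffunE => /(mulfI (t0 l)).
apply/vspaceP => v; apply/idP/memv_imgP => [vV|[w wX ->]]; last first.
  by rewrite lfunE; apply/VE.
have vE : v = diag_act t (diag_act (fun l => (t l)^-1) v).
  by apply/ffunP => l; rewrite !ffunE mulrA mulfV // mul1r.
by exists (diag_act (fun l => (t l)^-1) v); [apply/VE; rewrite -vE | rewrite lfunE].
Qed.

Lemma mem_torus_gchart c Y t v : (forall i, t i != 0) ->
  v \in val (gchart c Y) <->
  diag_act t v \in val (gchart c (fun i j => Y i j * (t j / t i))).
Proof.
move=> t0; rewrite !mem_gchart.
have E j : \sum_(i in val c) diag_act t v i * (Y i j * (t j / t i)) =
           t j * \sum_(i in val c) v i * Y i j.
  rewrite mulr_sumr; apply: eq_bigr => i _; rewrite ffunE.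
  by field; apply: t0.
split=> vE j /vE; rewrite E; first by rewrite ffunE => ->.
by rewrite ffunE => /(mulfI (t0 j)).
Qed.

Lemma torus_orbit_gchart c Y t : (forall i, t i != 0) ->
  torus_orbit (gchart c Y) (gchart c (fun i j => Y i j * (t j / t i))).
Proof.
by move=> t0; apply/torus_orbitP; exists t; split=> // v; apply: mem_torus_gchart.
Qed.

Lemma torus_orbit_gchartP c Y V : torus_orbit (gchart c Y) V ->
  exists t, (forall i, t i != 0) /\ V = gchart c (fun i j => Y i j * (t j / t i)).
Proof.
move=> /torus_orbitP[t [t0 tV]]; exists t; split=> //.
apply: Gr_eq => v; have -> : v = diag_act t (diag_act (fun l => (t l)^-1) v).
  by apply/ffunP => l; rewrite !ffunE mulrA mulfV // mul1r.
by rewrite -tV; apply: mem_torus_gchart.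
Qed.

(** The torus preserves the chart, so an equation of the orbit in the chart extends to a closed set
    containing the whole orbit. *)
Lemma closure_polyfun c Y (f : affine F (Gr_coord c) -> F) (A : affine F (Gr_coord c)) :
  polyfun f ->
  (forall t, (forall i, t i != 0) -> f (coords c (fun i j => Y i j * (t j / t i))) = 0) ->
  orbit_closure (gchart c Y) (chart (M := Gr F 'I_n k) c A) -> f A = 0.
Proof.
move=> pf f0 /(_ _ (zclosed_polyfun pf)) /= fA; apply: fA => // V.
move=> /torus_orbit_gchartP[t [t0 ->]] B /chart_inj <-; exact: f0.
Qed.

Lemma gchart_limit (Z : set (Gr F 'I_n k)) c (q : 'I_n -> 'I_n -> {poly F})
    (r : {poly F}) (u0 : F) : zclosed Z -> r != 0 ->
  (forall u, r.[u] != 0 -> Z (gchart c (fun i j => (q i j).[u]))) ->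
  Z (gchart c (fun i j => (q i j).[u0])).
Proof.
move=> clZ r0 Zq.
have coordsE u : coords c (fun i j => (q i j).[u]) =
    [ffun p : Gr_coord c => (q (val p.1) (val p.2)).[u]] by [].
rewrite /gchart coordsE.
apply: (curve_limit (q := fun p : Gr_coord c => q (val p.1) (val p.2)) u0 (clZ c) r0).
exact: Zq.
Qed.

Section NoSquare.
Variables (c : Gr_index 'I_n k) (Y : 'I_n -> 'I_n -> F).
Local Notation Z := (orbit_closure (gchart c Y)).
Local Notation chart := (chart (M := Gr F 'I_n k)).

(* The one-parameter subgroup scaling the rows other than [i0] by [1/s] and the
   columns other than [j0] by [s] kills all entries but one as [s] tends to 0. *)
Lemma closure_coordinate_line i0 j0 u : i0 \in val c -> j0 \notin val c ->
  Y i0 j0 != 0 ->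
  Z (gchart c (fun i j => ((i == i0) && (j == j0))%:R * u)).
Proof.
move=> i0c j0c Y0 Z' clZ' orbZ'.
(* The value 0 is in turn a limit of nonzero values. *)
suff nz v : v != 0 -> Z' (gchart c (fun i j => ((i == i0) && (j == j0))%:R * v)).
  have := @gchart_limit Z' c (fun i j => ((i == i0) && (j == j0))%:R *: 'X) 'X u clZ'.
  rewrite polyX_eq0 => /(_ isT) limZ'.
  rewrite (_ : gchart c _ = gchart c (fun i j =>
    (((i == i0) && (j == j0))%:R *: 'X : {poly F}).[u])).
    apply: limZ' => v; rewrite hornerX => /nz; congr Z'; congr gchart.
    by apply/funext => i; apply/funext => j; rewrite hornerZ hornerX.
  by congr gchart; apply/funext => i; apply/funext => j; rewrite hornerZ hornerX.
(* Scaling the column [j0] by [a] makes the surviving entry equal to [v]. *)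
move=> v0; pose a := v / Y i0 j0.
have a0 : a != 0 by rewrite mulf_neq0 // invr_eq0.
pose q i j : {poly F} := Y i j *: (if i == i0 then (if j == j0 then a%:P else 'X)
  else (if j == j0 then a *: 'X else 'X^2)).
rewrite (_ : gchart c _ = gchart c (fun i j => (q i j).[0])); last first.
  congr gchart; apply/funext => i; apply/funext => j; rewrite /q hornerZ.
  have [->|_] := eqVneq i i0; have [->|_] := eqVneq j j0;
    rewrite /= ?hornerZ ?hornerC ?hornerX ?hornerXn ?expr0n /= ?mulr0 ?mul0r //.
  by rewrite mul1r /a mulrC mulfVK.
apply: (@gchart_limit _ _ q 'X) => //; first by rewrite polyX_eq0.
move=> s; rewrite hornerX => s0; apply: orbZ'.
pose t i := if i \in val c then (if i == i0 then 1 else s^-1)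
            else (if i == j0 then a else s).
have t0 i : t i != 0 by rewrite /t; do 2 case: ifP => _; rewrite ?oner_eq0 ?invr_eq0.
rewrite (_ : gchart c (fun i j => (q i j).[s]) =
  gchart c (fun i j => Y i j * (t j / t i))).
  exact: torus_orbit_gchart.
apply: eq_gchart => i j ic jc; rewrite /q /t ic (negPf jc) hornerZ; congr (_ * _).
by case: ifP => _; case: ifP => _;
  rewrite ?hornerZ ?hornerC ?hornerX ?hornerXn ?invr1 ?mulr1 ?invrK ?expr2.
Qed.

Lemma smooth_no_square i1 i2 j1 j2 : smooth Z ->
  i1 \in val c -> i2 \in val c -> j1 \notin val c -> j2 \notin val c ->
  i1 != i2 -> j1 != j2 -> Y i1 j1 != 0 -> Y i1 j2 != 0 -> Y i2 j1 != 0 ->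
  Y i2 j2 != 0 -> False.
Proof.
move=> smZ i1c i2c j1c j2c i12 j12 Y11 Y12 Y21 Y22.
pose S := [set a : Gr_coord c | Y (val a.1) (val a.2) != 0].
pose delta (a : Gr_coord c) : affine F (Gr_coord c) := [ffun b => (b == a)%:R].
have deltaE (a b : Gr_coord c) :
    (b == a) = (val b.1 == val a.1) && (val b.2 == val a.2).
  by case: a b => [a1 a2] [b1 b2]; apply/eqP/andP => /= [[-> ->]|[/eqP/val_inj -> /eqP/val_inj ->]].
have coordsE a u :
    coords c (fun i j => ((i == val a.1) && (j == val a.2))%:R * u) = u *: delta a.
  by apply/ffunP => b; rewrite !ffunE deltaE [RHS]mulrC.
have lineZ a u : a \in S -> Z (chart c (u *: delta a)).
  rewrite inE => aS; have := closure_coordinate_line u (valP a.1) (valP a.2) aS.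
  by rewrite /gchart coordsE.
pose I1 : {i | i \in val c} := exist _ i1 i1c.
pose I2 : {i | i \in val c} := exist _ i2 i2c.
pose J1 : {j | j \notin val c} := exist _ j1 j1c.
pose J2 : {j | j \notin val c} := exist _ j2 j2c.
have Z0 : Z (chart c 0).
  by rewrite -(scale0r (delta (I1, J1))); apply: lineZ; rewrite inE.
have [T [TE [chainT _]]] := smZ c 0 Z0.
(* A line through the origin contained in the closure is a tangent direction there. *)
have deltaT a : a \in S -> delta a \in T.
  move=> aS; apply/TE => p Zp; apply: differential_line => u.
  by rewrite add0r; apply: Zp; apply: lineZ.
have dimT : (#|S| <= \dim T)%N.
  have injE : injective (@extend0 F (Gr_coord c) (mem S)).
    by move=> u v uv; apply/ffunP => i; rewrite -!extend0_val uv.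
  have <- : \dim (linfun (@extend0 F (Gr_coord c) (mem S)) @: fullv) = #|S|.
    rewrite limg_dim_eq.
      by rewrite dimvf /dim /= /dim /= muln1 card_sig.
    apply/eqP; rewrite -subv0; apply/subvP => u; rewrite memv_cap memv_ker.
    case/andP=> _ /eqP; rewrite lfunE /= -(linear0 (@extend0 F (Gr_coord c) (mem S))).
    by move/injE => ->; rewrite mem0v.
  apply: dimvS; apply/subvP => _ /memv_imgP[u _ ->]; rewrite lfunE /=.
  rewrite (_ : extend0 u = \sum_(a in S) extend0 u a *: delta a).
    by apply: memv_suml => a /deltaT aT; apply: memvZ.
  apply/ffunP => b; rewrite sum_ffunE.
  have [bS|bS] := boolP (b \in S).
    rewrite (bigD1 b) //= !ffunE eqxx [_ *: _]mulr1 big1 ?addr0 // => a /andP[_ ab].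
    by rewrite !ffunE eq_sym (negPf ab) scaler0.
  rewrite extend0_out // big1 // => a aS; rewrite !ffunE.
  by case: eqP => [ba|_]; [rewrite ba aS in bS | rewrite scaler0].
(* Both monomials are scaled by the same factor under the torus, and the coefficients make [f]
   vanish at [Y]. *)
pose f (x : affine F (Gr_coord c)) : F :=
  Y i1 j2 * Y i2 j1 * (x (I1, J1) * x (I2, J2)) +
  - (Y i1 j1 * Y i2 j2 * (x (I1, J2) * x (I2, J1))).
have pf : polyfun f.
  by apply: polyfunD; last apply: polyfunN; (apply: polyfunM; first exact: polyfunC);
     apply: polyfunM; apply: polyfunX.
have [b fE] := pf.
have ffunDE (x y : affine F (Gr_coord c)) a : (x + y) a = x a + y a :> F by rewrite ffunE.
suff: (\dim T < #|S|)%N by rewrite ltnNge dimT.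
(* At [x1] only the first monomial of [f] survives, so [f] does not vanish on the span of the axes
   in [S]. *)
apply: (chain_length_hypersurface (b := b) (x1 := delta (I1, J1) + delta (I2, J2))
  _ _ _ _ chainT).
- move=> A ZA a; rewrite inE negbK => /eqP Ya.
  apply: (@closure_polyfun c Y (fun x => x a) _ _ _ ZA); first exact: polyfunX.
  by move=> t _; rewrite ffunE Ya mul0r.
- move=> A ZA; rewrite -fE; apply: (closure_polyfun pf _ ZA) => t t0.
  by rewrite /f !ffunE /=; field; rewrite !t0.
- move=> a aS; rewrite ffunDE !ffunE.
  case: eqP => [aE|_]; first by rewrite aE inE Y11 in aS.
  case: eqP => [aE|_]; first by rewrite aE inE Y22 in aS.
  by rewrite addr0.
- rewrite -fE /f !ffunDE !ffunE !deltaE /= !eqxx.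
  rewrite ![_ == i1]eq_sym ![_ == j1]eq_sym (negPf i12) (negPf j12) /=.
  by rewrite !addr0 !add0r !mulr1 !mulr0 oppr0 addr0 mulf_neq0.
Qed.

End NoSquare.
End Torus.

(** * Lines and hyperplanes on blocks of coordinates *)

Section Blocks.
Variables (F : fieldType) (J B : finType) (b : J -> B) (tau : B -> bool).
Implicit Types (w : J -> F) (v : affine F J) (a : B -> J).

(* On a block with [tau] the space is the line spanned by [w], on the other blocks
   it is the hyperplane with equation [w]. *)
Definition block_space w v : Prop := forall B0, if tau B0
  then forall l l', b l = B0 -> b l' = B0 -> v l * w l' = v l' * w l
  else \sum_(l | b l == B0) w l * v l = 0.

Definition block_section w a := forall B0, b (a B0) = B0 /\ w (a B0) != 0.

Definition block_nonzero w := forall B0, exists l, b l = B0 /\ w l != 0.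

Lemma block_nonzeroP w : block_nonzero w -> exists a, block_section w a.
Proof. by move=> /choice[a aP]; exists a. Qed.

(** The index set of a chart: only [a B0] on a line block, everything except [a B0] on a hyperplane
    block. *)
Definition block_basis a : {set J} := [set l | (l == a (b l)) == tau (b l)].

(** The matrix of [block_space] in that chart. On a line [v j] is [v i] times [w j / w i]; on a
    hyperplane the equation is solved for [v j]. *)
Definition block_coord w (i j : J) : F :=
  if b i == b j then (if tau (b j) then w j / w i else - (w i / w j)) else 0.

Lemma block_coord_line w a v j : block_section w a -> tau (b j) ->
  \sum_(i in block_basis a) v i * block_coord w i j =
  v (a (b j)) * (w j / w (a (b j))).
Proof.
move=> aw tj; have [baj _] := aw (b j).
have ajI : a (b j) \in block_basis a by rewrite inE baj eqxx tj.
rewrite (bigD1 (a (b j))) //= {1}/block_coord baj eqxx tj big1 ?addr0 // => i /andP[].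
rewrite inE /block_coord => /eqP iI iaj; case: eqP => [ij|]; last by rewrite mulr0.
by move: iI iaj; rewrite ij tj => ->.
Qed.

Lemma block_coord_hyperplane w a v B0 : block_section w a -> ~~ tau B0 ->
  \sum_(i in block_basis a) v i * block_coord w i (a B0) =
  - (\sum_(l | (b l == B0) && (l != a B0)) w l * v l) / w (a B0).
Proof.
move=> aw tB; have [ba wa] := aw B0.
rewrite mulNr mulr_suml -sumrN big_mkcond [RHS]big_mkcond; apply: eq_bigr => l _.
rewrite inE /block_coord ba (negPf tB).
have [lB|lB] /= := eqVneq (b l) B0; last by rewrite mulr0; case: ifP.
rewrite lB (negPf tB) eqbF_neg; case: ifP => // _.
by rewrite mulrN mulrA [v l * _]mulrC.
Qed.

Lemma block_spaceP w a v : block_section w a -> block_space w v <->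
  forall j, j \notin block_basis a ->
    v j = \sum_(i in block_basis a) v i * block_coord w i j.
Proof.
move=> aw; split=> [bv j|vE B0].
  rewrite inE => jI; have [baj waj] := aw (b j); have := bv (b j).
  have [tj|tj] := boolP (tau (b j)).
    by rewrite block_coord_line // => /(_ j (a (b j)) erefl baj) vw; rewrite mulrA -vw mulfK.
  move: jI; rewrite (negPf tj) eqbF_neg negbK => /eqP jE.
  rewrite (bigD1 (a (b j))) ?baj //= => /eqP; rewrite addr_eq0 => /eqP vw.
  rewrite {2}jE block_coord_hyperplane // -vw {1}jE mulrC mulKf //.
have [ba wa] := aw B0; case: ifP => tB.
  have vl l : b l = B0 -> v l = v (a B0) * (w l / w (a B0)).
    move=> lB; have [->|la] := eqVneq l (a B0); first by rewrite divff ?mulr1.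
    by rewrite vE ?block_coord_line ?lB // inE lB tB (negPf la).
  by move=> l l' /vl -> /vl ->; field.
have aI : a B0 \notin block_basis a by rewrite inE ba eqxx tB.
rewrite (bigD1 (a B0)) ?ba //= (vE _ aI) block_coord_hyperplane ?tB // mulrC mulfVK //.
by rewrite addNr.
Qed.

End Blocks.

(** * Bipartite graphs without paths of three edges *)

Section StarForest.
Variables (J : finType) (I : {set J}) (adj : rel J).
Hypothesis adjC : ssrbool.symmetric adj.
Hypothesis adjI : forall x y, adj x y -> (x \in I) = (y \notin I).
Hypothesis adj_noP4 : forall x y z t,
  adj x y -> adj y z -> adj z t -> x = z \/ y = t.

(** When an edge is a whole component, both ends have a single neighbour; the tie is broken by
    taking the end outside [I] as the leaf. *)
Let leaf l y := adj l y /\ (forall y', adj l y' -> y' = y) /\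
  ((exists2 l', l' != l & adj y l') \/ l \notin I).

Let leaf_center l y z : leaf l y -> ~ leaf y z.
Proof.
move=> [ly [ul hl]] [yz [uy hy]].
have lz : l = z by apply: uy; rewrite adjC.
case: hl => [[l' l'l /uy l'z]|lI]; first by rewrite l'z lz eqxx in l'l.
case: hy => [[y' y'y]|yI]; first by rewrite -lz => /ul y'E; rewrite y'E eqxx in y'y.
by move: (adjI ly); rewrite (negPf lI) yI.
Qed.

Let adj_leaf l y : adj l y -> leaf l y \/ leaf y l.
Proof.
move=> ly; have yl : adj y l by rewrite adjC.
have [[y' y'y ly']|nl] := EM (exists2 y', y' != y & adj l y').
  right; split=> //; split; last by left; exists y'.
  (* A second neighbour [z] of [y] would give the path [z], [y], [l], [y']. *)
  move=> z yz; have := adj_noP4 (y := y) (z := l) (t := y') _ yl ly'.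
  by move=> /(_ z); rewrite adjC => /(_ yz) [//|yE]; rewrite yE eqxx in y'y.
have ul y' : adj l y' -> y' = y.
  by move=> ly'; have [//|y'y] := eqVneq y' y; case: nl; exists y'.
have [[l' l'l yl']|ny] := EM (exists2 l', l' != l & adj y l').
  by left; split=> //; split=> //; left; exists l'.
have uy l' : adj y l' -> l' = l.
  by move=> yl'; have [//|l'l] := eqVneq l' l; case: ny; exists l'.
have [lI|lI] := boolP (l \in I); last by left; split=> //; split=> //; right.
by right; split=> //; split=> //; right; rewrite -(adjI ly).
Qed.

Lemma star_forest_centers : exists c : J -> J,
  [/\ forall l, c (c l) = c l, forall l, c l != l -> adj l (c l)
    & forall l y, adj l y -> c l = c y].
Proof.
have /choice[c cP] : forall l, exists c,
    leaf l c \/ (c = l /\ forall y, ~ leaf l y).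
  move=> l; have [[y ly]|nl] := EM (exists y, leaf l y).
    by exists y; left.
  by exists l; right; split=> // y ly; apply: nl; exists y.
have cl l y : leaf l y -> c l = y.
  move=> ly; case: (cP l) => [[lcl _]|[_ /(_ y)//]].
  by case: ly => _ [ul _]; apply: ul.
have cy l y : leaf l y -> c y = y.
  by move=> ly; case: (cP y) => [/(leaf_center ly)//|[]].
exists c; split=> [l|l|l y].
- by case: (cP l) => [/cy//|[e _]]; rewrite !e.
- by case: (cP l) => [[]//|[-> _]]; rewrite eqxx.
by case/adj_leaf => h; rewrite (cl _ _ h) (cy _ _ h).
Qed.

End StarForest.

(** * Pivoting, and the block structure of a point with smooth orbit closure *)

Definition pivot (F : fieldType) (J : finType) (Y : J -> J -> F) (i0 j0 i j : J) : F :=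
  if i == j0 then (if j == i0 then (Y i0 j0)^-1 else Y i0 j / Y i0 j0)
  else (if j == i0 then - (Y i j0 / Y i0 j0) else Y i j - Y i j0 * Y i0 j / Y i0 j0).

(** Exchange of a basis index: the equation of column [j0] is solved for [v i0], which is then
    substituted in the other equations. *)
Lemma gchart_pivot (F : fieldType) (J : finType) k (c : Gr_index J k)
    (Y : J -> J -> F) i0 j0 : i0 \in val c -> j0 \notin val c -> Y i0 j0 != 0 ->
  exists c' : Gr_index J k, val c' = j0 |: (val c :\ i0) /\
    gchart c Y = gchart c' (pivot Y i0 j0).
Proof.
move=> i0c j0c Y0.
have j0c' : j0 \notin val c :\ i0 by rewrite !inE negb_and j0c orbT.
have cardc' : #|j0 |: (val c :\ i0)| == k.
  apply/eqP; apply: etrans (eqP (valP c)).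
  by rewrite cardsU1 j0c' (cardsD1 i0 (val c)) i0c.
exists (exist _ (j0 |: (val c :\ i0)) cardc'); split=> //.
apply: gchart_eqP => v /mem_gchart vE j /=; rewrite !inE !negb_or negb_and negbK.
have i0j0 : i0 != j0 by apply: contraNneq j0c => <-.
move=> /andP[jj0 jc]; rewrite big_setU1 //= /pivot eqxx.
have sumE (G : J -> F) : \sum_(i in val c) G i = G i0 + \sum_(i in val c :\ i0) G i.
  by rewrite (big_setD1 i0).
have vj0 := vE j0 j0c; rewrite sumE in vj0.
rewrite (eq_bigr (fun i => v i * (if j == i0 then - (Y i j0 / Y i0 j0)
   else Y i j - Y i j0 * Y i0 j / Y i0 j0))); last first.
  by move=> i; rewrite !inE; have [->|//] := eqVneq i j0; rewrite (negPf j0c) andbF.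
have [->|ji0] := eqVneq j i0.
  rewrite (eq_bigr (fun i => - (v i * Y i j0) / Y i0 j0)); last by move=> i _; field.
  by rewrite -mulr_suml sumrN vj0; field.
rewrite (negPf ji0) /= in jc.
rewrite (eq_bigr (fun i => v i * Y i j - (v i * Y i j0) * (Y i0 j / Y i0 j0))); last first.
  by move=> i _; field.
by rewrite (vE j jc) sumE vj0 sumrB -mulr_suml; field.
Qed.

Section SmoothBlocks.
Variables (F : numFieldType) (n k : nat).

Lemma smooth_no_path (c : Gr_index 'I_n k) (Y : 'I_n -> 'I_n -> F) i0 i1 j0 j1 :
  smooth (orbit_closure (gchart c Y)) ->
  i0 \in val c -> i1 \in val c -> j0 \notin val c -> j1 \notin val c ->
  i0 != i1 -> j0 != j1 -> Y i1 j0 != 0 -> Y i0 j0 != 0 -> Y i0 j1 != 0 -> False.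
Proof.
move=> smZ i0c i1c j0c j1c i01 j01 Y10 Y00 Y01.
have [Y11|Y11] := eqVneq (Y i1 j1) 0; last exact: (smooth_no_square smZ i0c i1c j0c j1c).
have [c' [c'E XE]] := gchart_pivot i0c j0c Y00; rewrite XE in smZ.
have ij i j : i \in val c -> j \notin val c -> i != j.
  by move=> ic jc; apply: contraNneq jc => <-.
have i1j0 := ij _ _ i1c j0c; have i0j1 := ij _ _ i0c j1c; have i0j0 := ij _ _ i0c j0c.
(* After the pivot the entry at [i1], [j1] is [- Y i1 j0 * Y i0 j1 / Y i0 j0], nonzero because
   [Y i1 j1] is zero. *)
apply: (@smooth_no_square _ _ _ c' _ j0 i1 i0 j1 smZ); rewrite ?c'E ?inE ?eqxx //.
- by rewrite i1c andbT [i1 == i0]eq_sym i01 orbT.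
- by rewrite orbF.
- by rewrite eq_sym (negPf j01) (negPf j1c) andbF.
- by rewrite eq_sym.
- by rewrite /pivot !eqxx invr_eq0.
- by rewrite /pivot eqxx [j1 == i0]eq_sym (negPf i0j1) mulf_neq0 // invr_eq0.
- by rewrite /pivot (negPf i1j0) eqxx oppr_eq0 mulf_neq0 // invr_eq0.
- rewrite /pivot (negPf i1j0) [j1 == i0]eq_sym (negPf i0j1) Y11 sub0r.
  by rewrite oppr_eq0 !mulf_neq0 // invr_eq0.
Qed.

Lemma smooth_block_space (X : Gr F 'I_n k) : smooth (orbit_closure X) ->
  exists r (b : 'I_n -> 'I_r) (tau : 'I_r -> bool) (w : 'I_n -> F),
    [/\ forall B0, exists l, b l = B0, forall l, w l != 0
      & forall v, v \in val X <-> block_space b tau w v].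
Proof.
have [c [Y ->]] := gchart_surj X => smZ.
pose adj l l' := [|| [&& l \in val c, l' \notin val c & Y l l' != 0]
                   | [&& l' \in val c, l \notin val c & Y l' l != 0]].
have adjC : ssrbool.symmetric adj by move=> l l'; rewrite /adj orbC.
have adjI x y : adj x y -> (x \in val c) = (y \notin val c).
  by case/orP=> /and3P[-> h _]; rewrite ?h // (negPf h).
have adjY x y : adj x y -> x \in val c -> Y x y != 0.
  by case/orP=> /and3P[xc yc //]; rewrite (negPf yc).
have adjP4 x y z t : adj x y -> adj y z -> adj z t -> x = z \/ y = t.
  move=> xy yz zt; have [->|xz] := eqVneq x z; first by left.
  have [->|yt] := eqVneq y t; first by right.
  have yx : adj y x by rewrite adjC.
  have zy : adj z y by rewrite adjC.
  have tz : adj t z by rewrite adjC.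
  have hx := adjI _ _ xy; have hy := adjI _ _ yz; have hz := adjI _ _ zt.
  have [yc|yc] := boolP (y \in val c).
    rewrite yc in hx hy; have zc : z \notin val c by rewrite -hy.
    have tc : t \in val c by move: hz; rewrite (negPf zc); case: (t \in _).
    case: (@smooth_no_path c Y y t z x smZ) => //; rewrite ?hx //;
      by [rewrite eq_sym | apply: adjY].
  rewrite (negPf yc) in hx hy; have zc : z \in val c by case: (z \in _) hy.
  have tc : t \notin val c by rewrite -hz.
  case: (@smooth_no_path c Y z x y t smZ) => //; rewrite ?hx //;
    by [rewrite eq_sym | apply: adjY => //; rewrite hx].
have [ctr [ctrK ctr_adj adj_ctr]] := star_forest_centers adjC adjI adjP4.
pose Bt : finType := {l : 'I_n | ctr l == l}.
have ctrP l : ctr (ctr l) == ctr l by apply/eqP.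
pose b l : 'I_#|Bt| := enum_rank (exist _ (ctr l) (ctrP l) : Bt).
pose a (B0 : 'I_#|Bt|) : 'I_n := val (enum_val B0).
have ab l : a (b l) = ctr l by rewrite /a /b enum_rankK.
have ba B0 : b (a B0) = B0.
  by apply: enum_val_inj; rewrite /b enum_rankK; apply/val_inj/eqP/(valP (enum_val B0)).
have bE l l' : (b l == b l') = (ctr l == ctr l').
  by apply/eqP/eqP => [ll'|ll']; [rewrite -!ab ll' | rewrite -(ba (b l)) -(ba (b l')) !ab ll'].
(* A centre in [val c] is the only row of its star, which gives a line; a centre outside is the only
   column, which gives a hyperplane. *)
pose tau B0 := a B0 \in val c.
(* The weight -1 absorbs the sign of [block_coord] on hyperplane blocks. An isolated vertex is its
   own centre and carries the full or the zero subspace of a one-dimensional space. *)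
pose w l : F := if ctr l == l then (if l \in val c then 1 else -1)
  else (if ctr l \in val c then Y (ctr l) l else Y l (ctr l)).
exists #|Bt|, b, tau, w.
have w0 l : w l != 0.
  rewrite /w; have [_|/ctr_adj lc] := eqVneq (ctr l) l.
    by case: ifP; rewrite ?oppr_eq0 oner_eq0.
  have cl : adj (ctr l) l by rewrite adjC.
  case: ifP => [/(adjY _ _ cl) //|nc].
  by apply: adjY => //; rewrite (adjI _ _ lc) nc.
split=> //; first by move=> B0; exists (a B0).
have aw : block_section b w a by move=> B0; split.
have cE : val c = block_basis b tau a.
  apply/setP => l; rewrite inE ab /tau ab; have [<-|lc] := eqVneq l (ctr l).
    by case: (l \in _).
  by rewrite (adjI l (ctr l)); [case: (ctr l \in _) | apply: ctr_adj; rewrite eq_sym].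
move=> v; rewrite (block_spaceP _ _ aw) -cE mem_gchart.
have YE i j : i \in val c -> j \notin val c -> Y i j = block_coord b tau w i j.
  move=> ic jc; rewrite /block_coord bE /tau ab.
  have [ij|ij] := eqVneq (ctr i) (ctr j); last first.
    apply/eqP; apply: contraNT ij => Yij; apply/eqP/adj_ctr.
    by rewrite /adj ic jc Yij.
  case: ifP => cj.
    have jcj : ctr j != j by apply: contraNneq jc => <-.
    have ici : ctr i = i.
      apply/eqP; apply: contraT => /ctr_adj/adjI; by rewrite ij ic cj.
    by rewrite /w (negPf jcj) cj ici eqxx ic divr1 -ij ici.
  have cji : ctr i != i by rewrite ij; apply: contraTneq ic => <-; rewrite cj.
  have cjj : ctr j = j.
    by apply/eqP; apply: contraT => /ctr_adj/adjI; rewrite (negPf jc) cj.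
  by rewrite /w (negPf cji) cjj eqxx (negPf jc) ij cjj (negPf jc) invrN1 mulrN1 opprK.
split=> vE j jc; rewrite vE //; apply: eq_bigr => i ic; by rewrite YE.
Qed.

End SmoothBlocks.

(** * The closed set of points with weights that may partly vanish *)

Section BlockPoints.
Variables (F : fieldType) (J B : finType) (k : nat) (b : J -> B) (tau : B -> bool).
Implicit Types (w : J -> F) (v : affine F J) (a : B -> J) (V : Gr F J k).
Implicit Types (c : Gr_index J k) (Y : J -> J -> F).
Local Notation space := (block_space b tau).
Local Notation coord := (block_coord b tau).
Local Notation basis := (block_basis b tau).

Definition block_point w V := forall v, v \in val V <-> space w v.

(** The future orbit closure: weights may vanish, but not on a whole block, so that the dimension
    does not jump. *)
Definition block_points : set (Gr F J k) :=
  [set V | exists w, block_nonzero b w /\ block_point w V]%classic.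

Lemma block_point_inj w V V' : block_point w V -> block_point w V' -> V = V'.
Proof. by move=> wV wV'; apply: Gr_eq => v; rewrite wV wV'. Qed.

Lemma block_point_gchart w a c : block_section b w a -> val c = basis a ->
  block_point w (gchart c (coord w)).
Proof. by move=> aw cE v; rewrite mem_gchart (block_spaceP _ _ aw) cE. Qed.

Lemma block_space_line w B0 : tau B0 -> space w [ffun l => if b l == B0 then w l else 0].
Proof.
move=> tB B1; case: ifP => tB1.
  by move=> l l' lB l'B; rewrite !ffunE lB l'B; case: ifP => _; rewrite ?mul0r // mulrC.
rewrite big1 // => l /eqP lB; rewrite ffunE lB.
by case: eqP => [B10|_]; [rewrite B10 tB in tB1 | rewrite mulr0].
Qed.

Lemma block_space_hyperplane w l l' : b l = b l' -> ~~ tau (b l) -> l != l' ->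
  space w [ffun i => if i == l then w l' else if i == l' then - w l else 0].
Proof.
move=> ll' tl ne B1; case: ifP => tB1.
  have nB i : b i = B1 -> (i == l = false) /\ (i == l' = false).
    move=> iB; split; apply: contraFF (negPf tl) => /eqP e; first by rewrite -e iB.
    by rewrite ll' -e iB.
  by move=> i i' /nB[il il'] /nB[i'l i'l']; rewrite !ffunE il il' i'l i'l' !mul0r.
have [lB|lB] := eqVneq (b l) B1; last first.
  rewrite big1 // => i /eqP iB; rewrite ffunE.
  have [il|_] := eqVneq i l; first by rewrite -il iB eqxx in lB.
  have [il|_] := eqVneq i l'; last by rewrite mulr0.
  by rewrite ll' -il iB eqxx in lB.
rewrite (bigD1 l) ?lB //= (bigD1 l') /=; last by rewrite -ll' lB eqxx eq_sym.
rewrite big1 => [|i /andP[/andP[_ il] il']]; last by rewrite ffunE (negPf il) (negPf il') mulr0.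
by rewrite !ffunE eqxx eq_sym (negPf ne) eqxx; ring.
Qed.

(** A vector of the point is determined by its coordinates in [c], and these can be prescribed
    freely. This forces exactly one coordinate of [c] in each line block and exactly one missing in
    each hyperplane block. *)
Lemma block_point_section w c Y : block_nonzero b w -> block_point w (gchart c Y) ->
  exists a, block_section b w a /\ val c = basis a.
Proof.
move=> nzw wV.
have deltaV l : l \in val c -> space w (graph_vec c Y (fun i => (i == l)%:R)).
  by move=> lc; apply/wV/mem_graph_vec.
have /choice[a aP] : forall B0, exists l, [/\ b l = B0, w l != 0 &
    forall l', b l' = B0 -> (l' \in val c) = ((l' == l) == tau B0)].
  move=> B0; have [tB|tB] := boolP (tau B0).
    have [i [ic]] : exists i, i \in val c /\ (if b i == B0 then w i else 0) != 0.
      apply: contrapT => ni; have [l [lB wl]] := nzw B0.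
      have := gchart_eq0 (iffRL (wV _) (block_space_line w tB)).
      move=> /(_ _)/ffunP/(_ l); rewrite !ffunE lB eqxx => wl0.
      suff: w l = 0 by apply/eqP.
      apply: wl0 => i ic; rewrite ffunE; apply: contrapT => /eqP wi.
      by apply: ni; exists i.
    case: (b i =P B0) => [iB wi|_]; last by rewrite eqxx.
    exists i; split=> // l lB; rewrite eqb_id; have [->//|li] := eqVneq l i.
    apply/negP => lc; have := deltaV l lc B0; rewrite tB => /(_ l i lB iB).
    rewrite !ffunE lc ic eqxx mul1r eq_sym (negPf li) mul0r => /eqP.
    by rewrite (negPf wi).
  have [i [iB ic wi]] : exists i, [/\ b i = B0, i \notin val c & w i != 0].
    apply: contrapT => ni; have [l [lB wl]] := nzw B0.
    have outc i : b i = B0 -> i \notin val c -> w i = 0.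
      by move=> iB ic; apply: contrapT => /eqP wi; apply: ni; exists i.
    have lc : l \in val c by apply: contraNT wl => /(outc l lB) ->.
    have := deltaV l lc B0; rewrite (negPf tB) (bigD1 l) ?lB //= ffunE lc eqxx mulr1.
    rewrite big1 ?addr0 => [/eqP|i /andP[/eqP iB il]]; first by rewrite (negPf wl).
    rewrite ffunE (negPf il); case: ifP => [_|/negbT ic]; first by rewrite mulr0.
    by rewrite outc ?mul0r.
  exists i; split=> // l lB; rewrite eqbF_neg; have [->|li] := eqVneq l i; first exact: negPf.
  apply: contrapT => /negP lc.
  have := gchart_eq0 (iffRL (wV _) (block_space_hyperplane w (l := l) (l' := i) _ _ li)).
  rewrite lB iB => /(_ erefl tB _)/ffunP/(_ l); rewrite !ffunE eqxx => wi0.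
  suff: w i = 0 by apply/eqP.
  apply: wi0 => j jc; rewrite ffunE.
  have [jl|_] := eqVneq j l; first by rewrite -jl jc in lc.
  by have [ji|//] := eqVneq j i; rewrite -ji jc in ic.
exists a; split=> [B0|]; first by have [] := aP B0.
by apply/setP => l; rewrite inE; have [_ _ ->] := aP (b l).
Qed.

Lemma block_pointE w a c V : block_section b w a -> val c = basis a ->
  block_point w V -> V = gchart c (coord w).
Proof. by move=> aw cE wV; apply: block_point_inj wV (block_point_gchart aw cE). Qed.

(** Weights read off from a chart matrix, normalised on the section; inverse to [block_coord] on
    matrices without entries between different blocks. *)
Definition block_weights a Y (l : J) : F := if tau (b l)
  then (if l == a (b l) then 1 else Y (a (b l)) l)
  else (if l == a (b l) then -1 else Y l (a (b l))).

Lemma block_weights_section a Y : (forall B0, b (a B0) = B0) ->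
  block_section b (block_weights a Y) a.
Proof.
move=> ba B0; split=> //; rewrite /block_weights ba eqxx.
by case: ifP; rewrite ?oppr_eq0 oner_eq0.
Qed.

Lemma block_coord_weights a Y i j : i \in basis a -> j \notin basis a ->
  coord (block_weights a Y) i j = if b i == b j then Y i j else 0.
Proof.
rewrite !inE /block_coord /block_weights => iI jI.
case: eqP => // ij; move: iI jI; rewrite ij; case: ifP => tj.
  by rewrite !eqb_id => /eqP -> /negPf ->; rewrite tj eqxx divr1.
by rewrite !eqbF_neg negbK => /negPf -> /eqP <-; rewrite tj eqxx invrN1 mulrN1 opprK.
Qed.

Lemma gchart_block_points a c Y : (forall B0, b (a B0) = B0) -> val c = basis a ->
  (forall i j, i \in val c -> j \notin val c -> b i != b j -> Y i j = 0) ->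
  block_point (block_weights a Y) (gchart c Y).
Proof.
move=> ba cE Y0; have aw := block_weights_section Y ba.
rewrite (@eq_gchart _ _ _ _ _ (coord (block_weights a Y))); first exact: block_point_gchart.
move=> i j ic jc; rewrite block_coord_weights -?cE //.
by case: ifP => // /negbT; apply: Y0.
Qed.

(** In a chart indexed by a [block_basis] these points form the linear space of matrices with no
    entries between different blocks; the other charts contain none of them. *)
Lemma zclosed_block_points : zclosed block_points.
Proof.
move=> c; have [[a [ba cE]]|na] :=
  EM (exists a, (forall B0, b (a B0) = B0) /\ val c = basis a); last first.
  rewrite (_ : _ @^-1` _ = set0)%classic; first exact: algebraic_set0.
  apply/seteqP; split=> A //= [w [nzw]]; have [Y ->] := coords_surj A.
  move=> /(block_point_section nzw)[a [aw cE]]; apply: na; exists a; split=> // B0.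
  by have [] := aw B0.
rewrite (_ : _ @^-1` _ = [set A : affine F (Gr_coord c) | forall ij : Gr_coord c,
  b (val ij.1) != b (val ij.2) -> A ij = 0])%classic.
  by apply: algebraic_polyfun => ij _; apply: polyfunX.
apply/seteqP; split=> A /=; have [Y ->] := coords_surj A.
  move=> [w [nzw wV]] ij bij; rewrite ffunE; have [a' [a'w cE']] := block_point_section nzw wV.
  rewrite (gchart_inj (block_pointE a'w cE' wV) (valP ij.1) (valP ij.2)).
  by rewrite /block_coord (negPf bij).
move=> Y0; exists (block_weights a Y); split.
  by move=> B0; exists (a B0); apply: block_weights_section.
apply: gchart_block_points => // i j ic jc bij.
by have := Y0 (exist _ i ic, exist _ j jc) bij; rewrite ffunE.
Qed.

Lemma card_block_basis a : (forall B0, b (a B0) = B0) ->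
  #|basis a| = (\sum_B0 (if tau B0 then 1 else #|[set l | b l == B0]| - 1))%N.
Proof.
move=> ba; rewrite -sum1_card (partition_big b predT) //=; apply: eq_bigr => B0 _.
case: ifP => tB.
  rewrite (big_pred1 (a B0)) // => l; rewrite inE /=.
  apply/andP/eqP => [[/eqP lI /eqP lB]|->]; last by rewrite ba tB !eqxx.
  by move: lI; rewrite lB tB => /eqP.
rewrite (cardsD1 (a B0)) inE ba eqxx add1n subn1 /= -sum1_card.
apply: eq_bigl => l; rewrite !inE; have [lB|] := eqVneq (b l) B0; last by rewrite !andbF.
by rewrite lB tB eqbF_neg.
Qed.

End BlockPoints.

(** * The orbit closure *)

Section BlockClosure.
Variables (F : numFieldType) (n k : nat) (B : finType) (b : 'I_n -> B) (tau : B -> bool).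
Implicit Types (w : 'I_n -> F) (V X : Gr F 'I_n k) (t : 'I_n -> F).

(** A spanning vector is multiplied by [t], an equation is divided by it. *)
Lemma block_space_torus w w' t (v : affine F 'I_n) : (forall l, t l != 0) ->
  (forall l, w' l = if tau (b l) then t l * w l else w l / t l) ->
  block_space b tau w v <-> block_space b tau w' (diag_act t v).
Proof.
move=> t0 w'E; split=> wv B0; have := wv B0; case: ifP => tB.
- move=> h l l' lB l'B; rewrite !ffunE !w'E lB l'B tB mulrACA (h _ _ lB l'B).
  by ring.
- move=> h; rewrite -[RHS]h; apply: eq_bigr => l /eqP lB; rewrite ffunE w'E lB tB.
  by field; apply: t0.
- move=> h l l' lB l'B; apply: (mulfI (mulf_neq0 (t0 l) (t0 l'))).
  have := h l l' lB l'B; rewrite !ffunE !w'E lB l'B tB => e.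
  by transitivity (t l * v l * (t l' * w l')); [ring | rewrite e; ring].
- move=> h; rewrite -[RHS]h; apply: eq_bigr => l /eqP lB; rewrite ffunE w'E lB tB.
  by field; apply: t0.
Qed.

Lemma block_point_orbit w w' X V : (forall l, w l != 0) -> (forall l, w' l != 0) ->
  block_point b tau w X -> block_point b tau w' V -> torus_orbit X V.
Proof.
move=> w0 w'0 wX w'V; apply/torus_orbitP.
exists (fun l => if tau (b l) then w' l / w l else w l / w' l).
have t0 l : (if tau (b l) then w' l / w l else w l / w' l) != 0.
  by case: ifP => _; rewrite mulf_neq0 ?invr_eq0.
split=> // v; rewrite wX w'V; apply: block_space_torus => // l.
by case: (tau (b l)); [rewrite mulfVK | rewrite invf_div mulrC mulfVK].
Qed.

Lemma torus_orbit_block_points w X V : block_nonzero b w -> block_point b tau w X ->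
  torus_orbit X V -> block_points b tau V.
Proof.
move=> nzw wX /torus_orbitP[t [t0 tV]].
exists (fun l => if tau (b l) then t l * w l else w l / t l); split.
  move=> B0; have [l [lB wl]] := nzw B0; exists l; split=> //.
  by case: ifP => _; rewrite mulf_neq0 ?invr_eq0.
move=> v; have -> : v = diag_act t (diag_act (fun l => (t l)^-1) v).
  by apply/ffunP => l; rewrite !ffunE mulrA mulfV // mul1r.
rewrite -tV wX; exact: block_space_torus.
Qed.

(* A point with weights [w] is the limit of the points with weights
   [w + u (w0 - w)], normalised to have constant weights on the section [a]. *)
Lemma orbit_closure_block_points w0 X : block_nonzero b w0 -> (forall l, w0 l != 0) ->
  block_point b tau w0 X -> orbit_closure X = block_points b tau.
Proof.
move=> nzw0 w00 wX; apply/seteqP; split=> V.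
  apply; first exact: zclosed_block_points.
  by move=> W; apply: torus_orbit_block_points wX.
have [c [Y ->]] := gchart_surj V; move=> [w [nzw wV]] Z clZ orbZ.
have [a [aw cE]] := block_point_section nzw wV.
rewrite (block_pointE aw cE wV).
(* The chart matrix divides only by weights on the section; as these are constant in [u], its
   entries [q] are polynomials. *)
pose W l : {poly F} := if l == a (b l) then (w l)%:P else (w l)%:P + (w0 l - w l) *: 'X.
pose q i j : {poly F} := if b i == b j then
  (if tau (b j) then (w i)^-1 *: W j else - ((w j)^-1 *: W i)) else 0.
pose wu u l := (W l).[u].
have wuE u i j : i \in val c -> j \notin val c ->
    (q i j).[u] = block_coord b tau (wu u) i j.
  rewrite cE !inE /q /block_coord => ic jc; case: eqP => [ij|]; last by rewrite horner0.
  move: ic jc; rewrite ij; case: ifP => tj.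
    move=> /eqP/eqP ia _; rewrite hornerZ mulrC; congr (_ / _).
    by rewrite /wu /W ij -ia eqxx hornerC.
  rewrite !eqbF_neg negbK hornerN hornerZ mulrC => _ /eqP ja.
  by congr (- (_ / _)); rewrite /wu /W -ja eqxx hornerC.
have wu0 l : wu 0 l = w l.
  by rewrite /wu /W; case: ifP => _; rewrite !hornerE // ?mulr0 ?addr0.
have -> : gchart c (block_coord b tau w) = gchart c (fun i j => (q i j).[0]).
  apply: eq_gchart => i j ic jc; rewrite wuE //.
  by congr (block_coord _ _ _ _ _); apply/funext => l; rewrite wu0.
have Wa l : l = a (b l) -> w l != 0 by move=> ->; have [_] := aw (b l).
(* Off the roots of [r] all weights are nonzero and the point lies in the orbit. At [u = 1] the
   weights are those of [w0] off the section and of [w] on it, so [r] is not zero. *)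
apply: (gchart_limit (r := \prod_l W l)) => // [|u].
  apply/eqP => /(congr1 (horner^~ 1))/eqP; rewrite horner0 horner_prod; apply/negP.
  apply/prodf_neq0 => l _; rewrite /W.
  have [/Wa|_] := eqVneq l (a (b l)); first by rewrite hornerC.
  by rewrite hornerD hornerC hornerZ hornerX mulr1 addrC subrK.
rewrite horner_prod => /prodf_neq0 wu_neq0; apply: orbZ.
rewrite (@eq_gchart _ _ _ _ _ (block_coord b tau (wu u))); last exact: wuE.
apply: (block_point_orbit w00 (w' := wu u)) => //; first by move=> l; apply: wu_neq0.
apply: (block_point_gchart (a := a)) => // B0; split; last exact: wu_neq0.
by have [] := aw B0.
Qed.

End BlockClosure.

(** * Identification with a product of Grassmannians *)

Section SingleBlock.
Variables (F : fieldType) (J : finType).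
Let b (_ : J) := tt.

Lemma single_block_basis (t : bool) (a : unit -> J) :
  #|block_basis b (fun=> t) a| = if t then 1%N else (#|J| - 1)%N.
Proof.
rewrite card_block_basis; last by case.
rewrite (big_pred1 tt) => [|[]//]; case: ifP => // _.
by rewrite (_ : [set l | _] = [set: J]) ?cardsT //; apply/setP => l; rewrite !inE.
Qed.

(** With a single block, a set of one element, or of all elements but one, is a [block_basis], and
    there are no entries between different blocks to exclude. *)
Lemma single_block_point k (t : bool) (V : Gr F J k) :
  k = (if t then 1 else #|J| - 1)%N -> (0 < #|J|)%N ->
  exists w, block_nonzero b w /\ block_point b (fun=> t) w V.
Proof.
move=> kE J0; have [c [Y ->]] := gchart_surj V; have ck := eqP (valP c).
have [a0 cE] : exists a0 : J, val c = block_basis b (fun=> t) (fun=> a0).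
  case: t kE => kE.
    have /cards1P[a0 cE] : #|val c| == 1%N by rewrite ck kE.
    by exists a0; rewrite cE; apply/setP => l; rewrite !inE eqb_id.
  have /cards1P[a0 cE] : #|~: val c| == 1%N by rewrite cardsCs finset.setCK ck kE subKn.
  exists a0; rewrite -[LHS]finset.setCK cE; apply/setP => l.
  by rewrite !inE eqbF_neg.
have ba B0 : b ((fun=> a0) B0) = B0 by case: B0.
exists (block_weights b (fun=> t) (fun=> a0) Y); split.
  by move=> B0; exists a0; apply: (@block_weights_section F J unit b (fun=> t) (fun=> a0) Y ba).
exact: gchart_block_points.
Qed.

Lemma single_block_point_exists k (t : bool) (w : J -> F) :
  k = (if t then 1 else #|J| - 1)%N -> block_nonzero b w ->
  exists V : Gr F J k, block_point b (fun=> t) w V.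
Proof.
move=> kE /block_nonzeroP[a aw].
have ck : #|block_basis b (fun=> t) a| == k by rewrite single_block_basis kE.
exists (gchart (exist _ (block_basis b (fun=> t) a) ck) (block_coord b (fun=> t) w)).
exact: (block_point_gchart (a := a)).
Qed.

End SingleBlock.

Section BlockProduct.
Variables (F : numFieldType) (n k r : nat) (b : 'I_n -> 'I_r) (tau : 'I_r -> bool).

Definition block (i : 'I_r) : {set 'I_n} := [set l | b l == i].
Definition block_dim (i : 'I_r) : nat := if tau i then 1%N else (#|block i| - 1)%N.

Definition restrict (i : 'I_r) (v : affine F 'I_n) : affine F {l | l \in block i} :=
  [ffun l => v (val l)].

Lemma block_space_restrict (w : 'I_n -> F) v : block_space b tau w v <->
  forall i, block_space (fun=> tt) (fun=> tau i)
    (fun l : {l | l \in block i} => w (val l)) (restrict i v).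
Proof.
have sumE i : \sum_(l | b l == i) w l * v l =
    \sum_(l : {l | l \in block i} | tt == tt) w (val l) * restrict i v l.
  transitivity (\sum_(l in block i) w l * v l).
    by apply: eq_bigl => l; rewrite inE.
  by rewrite [LHS]big_sub; apply: eq_bigr => l _; rewrite ffunE.
split=> wv i; last first.
  have := wv i tt; case: ifP => ti; last by rewrite sumE.
  move=> h l l' li l'i; have lb : l \in block i by rewrite inE li.
  have l'b : l' \in block i by rewrite inE l'i.
  by have := h (exist _ l lb) (exist _ l' l'b) erefl erefl; rewrite !ffunE.
move=> []; have := wv i; case: ifP => ti; last by rewrite sumE.
move=> h l l' _ _; rewrite !ffunE; apply: h; apply/eqP.
  by have := valP l; rewrite inE.
by have := valP l'; rewrite inE.
Qed.

Lemma mem_sum_extend0 (U : forall i, {vspace affine F {l | l \in block i}}) v :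
  v \in (\sum_i linfun (@extend0 F 'I_n (mem (block i))) @: U i)%VS <->
  forall i, restrict i v \in U i.
Proof.
split=> [/memv_sumP[u uU ->] i|vU].
  have /memv_imgP[x xU ux] := uU i isT; suff -> : restrict i (\sum_j u j) = x by [].
  apply/ffunP => l; rewrite ffunE sum_ffunE (bigD1 i) //= ux lfunE /= extend0_val.
  rewrite big1 ?addr0 // => j ji; have /memv_imgP[y _ ->] := uU j isT.
  have lj : val l \notin block j.
    by have := valP l; rewrite !inE => /eqP ->; rewrite eq_sym.
  by rewrite lfunE /= extend0_out.
have -> : v = \sum_i linfun (@extend0 F 'I_n (mem (block i))) (restrict i v).
  apply/ffunP => l; rewrite sum_ffunE (bigD1 (b l)) //= big1 ?addr0 => [|j jl].
    have lb : l \in block (b l) by rewrite inE.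
    rewrite lfunE /= -[l in RHS]/(val (exist (fun l' => l' \in block (b l)) l lb)).
    by rewrite extend0_val ffunE.
  have lj : l \notin block j by rewrite inE eq_sym.
  by rewrite lfunE /= extend0_out.
by apply: memv_sumr => i _; apply/memv_imgP; exists (restrict i v); rewrite ?vU.
Qed.

Lemma card_block_sig i : #|{: {l | l \in block i}}| = #|block i|.
Proof. by rewrite card_sig; apply: eq_card => l. Qed.

Lemma Gr_product_block_points : (forall i, exists l, b l = i) ->
  Gr_product (k := k) block block_dim = block_points (F := F) b tau.
Proof.
move=> bsurj.
have blk0 i : (0 < #|{: {l | l \in block i}}|)%N.
  have [l lb] := bsurj i; rewrite card_block_sig card_gt0; apply/set0Pn.
  by exists l; rewrite inE lb.
have dimE i : block_dim i = (if tau i then 1 else #|{: {l | l \in block i}}| - 1)%N.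
  by rewrite card_block_sig.
apply/seteqP; split=> V /=.
  move=> [Y VE].
  have /choice[W WP] : forall i, exists W : 'I_n -> F,
      (exists l, b l = i /\ W l != 0) /\
      block_point (fun=> tt) (fun=> tau i) (fun l : {l | l \in block i} => W (val l)) (Y i).
    move=> i; have [w [nzw wY]] := single_block_point (Y i) (dimE i) (blk0 i).
    pose W l := if insub l is Some l' then w l' else 0.
    have WE : (fun l : {l | l \in block i} => W (val l)) = w.
      by apply/funext => l; rewrite /W valK.
    exists W; rewrite WE; split=> //.
    have [l [_ wl]] := nzw tt; exists (val l); rewrite /W valK; split=> //.
    by have := valP l; rewrite inE => /eqP.
  exists (fun l => W (b l) l); split.
    by move=> i; have [[l [li Wl]] _] := WP i; exists l; rewrite li.
  move=> v; rewrite VE mem_sum_extend0 block_space_restrict.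
  have E i : (fun l : {l | l \in block i} => W (b (val l)) (val l)) = (fun l => W i (val l)).
    by apply/funext => l; have := valP l; rewrite inE => /eqP ->.
  by split=> h i; have [_ wY] := WP i; have := h i; rewrite E wY.
move=> [w [nzw wV]].
have Yex i : exists Y : Gr F {l | l \in block i} (block_dim i),
    block_point (fun=> tt) (fun=> tau i) (fun l => w (val l)) Y.
  apply: single_block_point_exists => // -[].
  have [l [lB wl]] := nzw i; have lb : l \in block i by rewrite inE lB.
  by exists (exist _ l lb).
pose Y i := projT1 (cid (Yex i)); have YP i := projT2 (cid (Yex i)).
exists Y; apply/vspaceP => v; apply/idP/idP.
  move=> /wV/block_space_restrict h; apply/mem_sum_extend0 => i.
  by apply: (iffRL (YP i _)); exact: h.
by move=> /mem_sum_extend0 h; apply/wV/block_space_restrict => i; exact: (iffLR (YP i _) (h i)).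
Qed.

End BlockProduct.

(** * Isomorphism with a product of projective spaces *)

Section Proportional.
Variables (F : fieldType) (J B : finType) (k : nat) (b : J -> B) (tau : B -> bool).
Implicit Types (w : J -> F) (V : Gr F J k).

(** Equality of homogeneous coordinates on each block, cross-multiplied so that zero weights are
    allowed. *)
Definition proportional w w' := forall l l', b l = b l' -> w l * w' l' = w l' * w' l.

Lemma proportional_sym w w' : proportional w w' -> proportional w' w.
Proof. by move=> ww' l l' ll'; rewrite mulrC [RHS]mulrC ww'. Qed.

Lemma block_point_proportional w w' V :
  block_point b tau w V -> block_point b tau w' V -> proportional w w'.
Proof.
move=> wV w'V l l' ll'; have [tl|tl] := boolP (tau (b l)).
  have := iffLR (w'V _) (iffRL (wV _) (@block_space_line _ _ _ b tau w _ tl)).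
  by move=> /(_ (b l)); rewrite tl => /(_ l l' erefl (esym ll')); rewrite !ffunE eqxx ll' eqxx.
have [->//|ne] := eqVneq l l'.
have := iffLR (wV _) (iffRL (w'V _) (block_space_hyperplane w' ll' tl ne)).
move=> /(_ (b l)); rewrite (negPf tl) (bigD1 l) //= (bigD1 l') /=; last first.
  by rewrite -ll' eqxx eq_sym.
rewrite big1 => [|i /andP[/andP[_ il] il']]; last by rewrite ffunE (negPf il) (negPf il') mulr0.
rewrite !ffunE eqxx eq_sym (negPf ne) eqxx addr0 mulrN => /eqP.
by rewrite subr_eq0 => /eqP.
Qed.

Lemma proportional_block_point w w' V : block_nonzero b w -> block_nonzero b w' ->
  proportional w w' -> block_point b tau w V -> block_point b tau w' V.
Proof.
have sub u u' v : block_nonzero b u -> proportional u u' ->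
    block_space b tau u v -> block_space b tau u' v.
  move=> nzu uu' uv B0; have [a [aB ua]] := nzu B0; have := uv B0.
  have u'E l : b l = B0 -> u' l = u' a / u a * u l.
    move=> lB; apply: (mulfI ua); rewrite uu' ?aB // mulrA.
    by rewrite [u a * _]mulrC mulfVK // mulrC.
  case: ifP => _ h.
    by move=> l l' lB l'B; rewrite (u'E l lB) (u'E l' l'B) mulrCA (h _ _ lB l'B) mulrCA.
  rewrite (eq_bigr (fun l => u' a / u a * (u l * v l))); last first.
    by move=> l /eqP lB; rewrite (u'E _ lB) mulrA.
  by rewrite -mulr_sumr h mulr0.
move=> nzw nzw' ww' wV v; rewrite wV; split; apply: sub => //.
exact: proportional_sym.
Qed.

Lemma block_section_inj a a' : (forall B0, b (a B0) = B0) ->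
  (forall B0, b (a' B0) = B0) -> block_basis b tau a = block_basis b tau a' -> a = a'.
Proof.
move=> ba ba' aa'; apply/funext => B0; have := congr1 (fun S : {set J} => a B0 \in S) aa'.
by rewrite !inE ba eqxx; have [//|_] := eqVneq (a B0) (a' B0); case: (tau B0).
Qed.

End Proportional.

Section ChartCoordinates.
Variables (F : fieldType) (J : finType) (k : nat) (c : Gr_index J k).

Definition chart_entry (A : affine F (Gr_coord c)) i j : F :=
  if (insub i, insub j) is (Some i', Some j') then A (i', j') else 0.

Definition entry_poly i j : poly_on F (Gr_coord c) :=
  if (insub i, insub j) is (Some i', Some j') then 'X_(enum_rank (i', j')) else 0.

Lemma peval_entry i j A : peval (entry_poly i j) A = chart_entry A i j.
Proof.
rewrite /entry_poly /chart_entry; case: insub => [i'|]; last exact: meval0.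
by case: insub => [j'|]; [rewrite pevalX | apply: meval0].
Qed.

Lemma coords_entry A : coords c (chart_entry A) = A.
Proof. by apply/ffunP => -[i j]; rewrite ffunE /chart_entry /= !valK. Qed.

(** The maps to be shown regular are polynomial between suitable charts, so the denominator is taken
    to be 1. *)
Lemma gchart_fraction (I : finType) (y : affine F I) (Y : J -> J -> F)
    (T : J -> J -> poly_on F I) :
  (forall i j, i \in val c -> j \notin val c -> Y i j = peval (T i j) y) ->
  gchart c Y = chart (M := Gr F J k) c
    [ffun p => peval (T (val p.1) (val p.2)) y / peval 1%:MP y].
Proof.
move=> YT; rewrite (eq_gchart YT); congr chart; apply/ffunP => p.
by rewrite !ffunE pevalC divr1.
Qed.

End ChartCoordinates.

Section ProductCoordinates.
Variables (F : fieldType) (r : nat) (m : 'I_r -> nat).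
Local Notation N := (prod_charted (fun i => proj_space F (m i))).
Variable c : chart_index N.

Definition prod_entry (z : affine F (chart_coord c)) i (s s' : 'I_(m i).+1) : F :=
  if (insub s, insub s') is (Some t, Some t')
  then z (Tagged (fun i => chart_coord (c i) : Type) ((t, t') : Gr_coord (c i))) else 0.

Definition prod_entry_poly i (s s' : 'I_(m i).+1) : poly_on F (chart_coord c) :=
  if (insub s, insub s') is (Some t, Some t')
  then 'X_(enum_rank (Tagged (fun i => chart_coord (c i) : Type) ((t, t') : Gr_coord (c i))
    : chart_coord c)) else 0.

Lemma peval_prod_entry i s s' z :
  peval (prod_entry_poly s s') z = prod_entry (i := i) z s s'.
Proof.
rewrite /prod_entry_poly /prod_entry; case: insub => [t|]; last exact: meval0.
by case: insub => [t'|]; [rewrite pevalX | apply: meval0].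
Qed.

Lemma chart_prod_entry z i : chart c z i = gchart (c i) (prod_entry z (i := i)).
Proof.
rewrite /gchart; congr chart; apply/ffunP => -[s s'].
by rewrite !ffunE /prod_entry /= !valK.
Qed.

Lemma prod_chart_gchart (L : N) (h : forall i, 'I_(m i).+1 -> 'I_(m i).+1 -> F) :
  (forall i, L i = gchart (c i) (h i)) ->
  L = chart c [ffun p => h (tag p) (val (tagged p).1) (val (tagged p).2)].
Proof.
move=> Lh; apply: functional_extensionality_dep => i; rewrite Lh /gchart.
congr chart.
apply/ffunP => p.
rewrite [LHS]ffunE.
rewrite [RHS]ffunE.
by rewrite ffunE.
Qed.

Lemma prod_chart_fraction (I : finType) (y : affine F I) (L : N)
    (T : forall i, 'I_(m i).+1 -> 'I_(m i).+1 -> poly_on F I) :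
  (forall i, L i = gchart (c i) (fun s s' => peval (T i s s') y)) ->
  L = chart c [ffun p => peval (T (tag p) (val (tagged p).1) (val (tagged p).2)) y /
                         peval 1%:MP y].
Proof.
move=> /prod_chart_gchart ->; congr chart; apply/ffunP => p.
by rewrite !ffunE pevalC divr1.
Qed.

End ProductCoordinates.

(** The type ['I_(#|block b i|.-1).+1] is the one that [proj_space] uses for homogeneous
    coordinates. *)
Lemma block_enum n r (b : 'I_n -> 'I_r) (i : 'I_r) : (exists l, b l = i) ->
  exists erk : ('I_(#|block b i|.-1).+1 -> 'I_n) * ('I_n -> 'I_(#|block b i|.-1).+1),
  [/\ forall s, b (erk.1 s) = i, cancel erk.1 erk.2
    & forall l, b l = i -> erk.1 (erk.2 l) = l].
Proof.
move=> [l0 l0i]; have l0b : l0 \in block b i by rewrite inE l0i.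
have cardE : #|block b i| = (#|block b i|.-1).+1 by rewrite prednK // (cardD1 l0) l0b.
exists (fun s => enum_val (cast_ord (esym cardE) s),
        fun l => cast_ord cardE (enum_rank_in l0b l)); split=> [s|s|l li] /=.
- by have := enum_valP (cast_ord (esym cardE) s); rewrite inE => /eqP.
- by rewrite enum_valK_in cast_ordKV.
- by rewrite cast_ordK enum_rankK_in // inE li.
Qed.

Section BlockIsomorphism.
Variables (F : fieldType) (n k r : nat) (b : 'I_n -> 'I_r) (tau : 'I_r -> bool).
Hypothesis bsurj : forall i, exists l, b l = i.
Hypothesis dim_sum : (\sum_i block_dim b tau i)%N = k.
Local Notation m := (fun i : 'I_r => #|block b i|.-1).

Variables (block_elt : forall i, 'I_(m i).+1 -> 'I_n).
Variables (block_rank : forall i, 'I_n -> 'I_(m i).+1).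
Arguments block_elt {i} _.
Hypothesis block_elt_block : forall i (s : 'I_(m i).+1), b (block_elt s) = i.
Hypothesis block_eltK : forall i, cancel (@block_elt i) (@block_rank i).
Hypothesis block_rankK : forall i l, b l = i -> block_elt (block_rank i l) = l.

Local Notation M := (Gr F 'I_n k).
Local Notation N := (prod_charted (fun i => proj_space F (m i))).
Implicit Types (V : M) (L : N) (w : 'I_n -> F) (a : 'I_r -> 'I_n).

Definition line_point w L := forall i,
  block_point (fun=> tt) (fun=> true) (fun s => w (@block_elt i s)) (L i).

(** Both points have the same weights, so a hyperplane is sent to the line spanned by its equation.
    As weights are unique up to a scalar on each block, the relation is a bijection between
    [block_points] and the product. *)
Definition corresponds V L :=
  exists w, [/\ block_nonzero b w, block_point b tau w V & line_point w L].

Lemma block_nonzero_elt w i : block_nonzero b w ->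
  block_nonzero (fun=> tt) (fun s => w (@block_elt i s)).
Proof.
move=> nzw [] /=; have [l [li wl]] := nzw i; exists (block_rank i l).
by rewrite block_rankK.
Qed.

Lemma proportional_elt w w' : proportional b w w' <-> forall i,
  proportional (fun=> tt) (fun s => w (@block_elt i s)) (fun s => w' (@block_elt i s)).
Proof.
split=> [ww' i s s' _|ww' l l' ll']; first by rewrite ww' ?block_elt_block.
have := ww' (b l) (block_rank (b l) l) (block_rank (b l) l') erefl.
by rewrite !block_rankK.
Qed.

Lemma corresponds_proportionalr V w L : block_nonzero b w -> block_point b tau w V ->
  corresponds V L -> line_point w L.
Proof.
move=> nzw wV [w' [nzw' w'V w'L]] i.
have /proportional_elt ww' := block_point_proportional w'V wV.
by apply: proportional_block_point (ww' i) (w'L i); apply: block_nonzero_elt.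
Qed.

Lemma corresponds_proportionall V w L : block_nonzero b w -> line_point w L ->
  corresponds V L -> block_point b tau w V.
Proof.
move=> nzw wL [w' [nzw' w'V w'L]].
have ww' : proportional b w' w.
  by apply/proportional_elt => i; apply: block_point_proportional (w'L i) (wL i).
exact: proportional_block_point ww' w'V.
Qed.

Lemma corresponds_funr V L L' : corresponds V L -> corresponds V L' -> L = L'.
Proof.
move=> [w [nzw wV wL]] /(corresponds_proportionalr nzw wV) wL'.
by apply: functional_extensionality_dep => i; apply: block_point_inj (wL i) (wL' i).
Qed.

Lemma corresponds_funl V V' L : corresponds V L -> corresponds V' L -> V = V'.
Proof.
move=> [w [nzw wV wL]] /(corresponds_proportionall nzw wL).
exact: block_point_inj.
Qed.

Lemma line_point_exists w : block_nonzero b w -> exists L, line_point w L.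
Proof.
move=> nzw.
have Lex i : exists Li : Gr F 'I_(m i).+1 1,
    block_point (fun=> tt) (fun=> true) (fun s => w (@block_elt i s)) Li.
  by apply: single_block_point_exists => //; apply: block_nonzero_elt.
by exists (fun i => projT1 (cid (Lex i))) => i; apply: (projT2 (cid (Lex i))).
Qed.

Lemma corresponds_exr V : block_points b tau V -> exists L, corresponds V L.
Proof.
move=> [w [nzw wV]]; have [L wL] := line_point_exists nzw.
by exists L, w.
Qed.

Lemma block_index a : (forall i, b (a i) = i) ->
  {c : Gr_index 'I_n k | val c = block_basis b tau a}.
Proof.
move=> ba; have card_basis : #|block_basis b tau a| == k.
  by rewrite card_block_basis // -dim_sum; apply/eqP; apply: eq_bigr.
by exists (exist (fun I : {set 'I_n} => #|I| == k) _ card_basis).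
Qed.

Lemma corresponds_exl L : exists V, corresponds V L.
Proof.
have wex i : exists w : 'I_(m i).+1 -> F, block_nonzero (fun=> tt) w /\
    block_point (fun=> tt) (fun=> true) w (L i).
  by apply: single_block_point; rewrite // card_ord.
pose w l := projT1 (cid (wex (b l))) (block_rank (b l) l).
have wE i : (fun s => w (@block_elt i s)) = projT1 (cid (wex i)).
  by apply/funext => s; rewrite /w block_elt_block block_eltK.
have nzw : block_nonzero b w.
  move=> i; have [/(_ tt)[s [_ ws]] _] := projT2 (cid (wex i)).
  by exists (block_elt s); rewrite block_elt_block -[w _]/((fun s => w (@block_elt i s)) s) wE.
have [a aw] := block_nonzeroP nzw.
have [c cE] := block_index (fun i => (aw i).1).
exists (gchart c (block_coord b tau w)), w; split=> //.
  exact: (block_point_gchart aw cE).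
by move=> i; rewrite wE; have [] := projT2 (cid (wex i)).
Qed.

Lemma line_index a : exists c : chart_index N,
  forall i, val (c i) = [set block_rank i (a i)].
Proof.
exists (fun i => exist (fun I : {set 'I_(m i).+1} => #|I| == 1%N)
  [set block_rank i (a i)] (introT eqP (cards1 _))).
by [].
Qed.

Lemma line_point_gchart w a L i (c : Gr_index 'I_(m i).+1 1) :
  block_section b w a -> line_point w L -> val c = [set block_rank i (a i)] ->
  L i = gchart c (fun _ s => w (block_elt s) / w (a i)).
Proof.
move=> aw wL cE; have [ai wi] := aw i.
have sec : block_section (fun=> tt) (fun s => w (@block_elt i s)) (fun=> block_rank i (a i)).
  by move=> []; rewrite block_rankK.
have cE' : val c = block_basis (fun=> tt) (fun=> true) (fun=> block_rank i (a i)).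
  by rewrite cE; apply/setP => s; rewrite !inE eqb_id.
rewrite (block_pointE sec cE' (wL i)); apply: eq_gchart => s s' sI _.
by move: sI; rewrite cE inE /block_coord => /eqP ->; rewrite block_rankK.
Qed.

Lemma regular_to_lines (f : M -> N) :
  (forall V, block_points b tau V -> corresponds V (f V)) ->
  regular_on (block_points b tau) f.
Proof.
move=> fP V [w [nzw wV]]; have [a aw] := block_nonzeroP nzw.
have ba i := (aw i).1; have [c cE] := block_index ba; have [c' c'E] := line_index a.
(* The ratio of the weights at an index and at [a i] is, up to sign, one entry of the chart matrix:
   in row [a i] for a line, in column [a i] for a hyperplane. *)
pose T i (s s' : 'I_(m i).+1) : poly_on F (Gr_coord c) :=
  if tau i then entry_poly F c (a i) (block_elt s')
  else - entry_poly F c (block_elt s') (a i).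
exists c, (coords c (block_coord b tau w)), c'.
exists (fun p => T (tag p) (val (tagged p).1) (val (tagged p).2)), 1%:MP.
split; first exact/esym/(block_pointE aw cE wV).
  by rewrite pevalC oner_eq0.
move=> y Zy _; have [w' [nzw' w'V w'L]] := fP _ Zy.
apply: prod_chart_fraction => i; move: w'V w'L; move: (f _) => L w'V w'L.
rewrite -[y]coords_entry -/(gchart _ _) in w'V.
have [a' [a'w' cE']] := block_point_section nzw' w'V.
(* The chart determines the section, so one normalisation serves the whole chart. *)
have aE : a' = a.
  by apply: (block_section_inj (tau := tau)) => [j|//|]; [have [] := a'w' j | rewrite -cE -cE'].
move: a'w' cE'; rewrite aE => aw' cE'.
have yE := gchart_inj (block_pointE aw' cE' w'V).
rewrite (line_point_gchart aw' w'L (c'E i)); apply: eq_gchart => s s' _ s'I.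
rewrite /T; set l := block_elt s'.
have li : b l = i by apply: block_elt_block.
have la : l != a i.
  by move: s'I; rewrite c'E inE; apply: contraNneq => la; rewrite -[s']block_eltK -/l la.
have aI : (a i \in val c) = tau i by rewrite cE inE ba eqxx; case: (tau i).
have lI : (l \in val c) = ~~ tau i by rewrite cE inE li (negPf la); case: (tau i).
case: ifPn => ti; [|rewrite pevalN]; rewrite peval_entry yE ?aI ?lI ?ti //.
  by rewrite /block_coord ba li eqxx ti.
by rewrite /block_coord ba li eqxx (negPf ti) opprK.
Qed.

Lemma regular_from_lines (g : N -> M) : (forall L, corresponds (g L) L) ->
  regular_on [set: N]%classic g.
Proof.
move=> gP L _; have [w [nzw wV wL]] := gP L; have [a aw] := block_nonzeroP nzw.
have ba i := (aw i).1; have [c cE] := block_index ba; have [c' c'E] := line_index a.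
pose rk l := block_rank (b l) l; pose rka l := block_rank (b l) (a (b l)).
pose T i j : poly_on F (chart_coord c') :=
  if b i == b j then (if tau (b j) then prod_entry_poly c' (rka j) (rk j)
    else - prod_entry_poly c' (rka i) (rk i)) else 0.
have LE i := line_point_gchart aw wL (c'E i).
exists c'; eexists; exists c, (fun p : Gr_coord c => T (val p.1) (val p.2)), 1%:MP.
split; [exact/esym/(prod_chart_gchart LE) | by rewrite pevalC oner_eq0|].
move=> z _ _; have := gP (chart c' z).
have := @chart_prod_entry F r (fun i => #|block b i|.-1) c' z.
move: (chart c' z) => L' L'E gL'.
(* Homogeneous coordinates of the point with chart coordinates [z], normalised to 1 on the
   section. *)
pose wz l := if l == a (b l) then 1 else prod_entry z (rka l) (rk l).
have wz1 l : l = a (b l) -> wz l = 1 by rewrite /wz => /eqP ->.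
have awz : block_section b wz a by move=> i; rewrite wz1 ?ba ?oner_eq0.
have nzwz : block_nonzero b wz by move=> i; exists (a i).
have wzL' : line_point wz L'.
  move=> i; rewrite L'E.
  have c'E' : val (c' i) = block_basis (fun=> tt) (fun=> true) (fun=> block_rank i (a i)).
    by rewrite c'E; apply/setP => s; rewrite !inE eqb_id.
  have := gchart_block_points (b := fun=> tt) _ c'E' (Y := prod_entry z (i := i)).
  rewrite (_ : block_weights _ _ _ _ = (fun s => wz (@block_elt i s))).
    by apply => // -[].
  apply/funext => s; rewrite /block_weights /wz /rka /rk block_elt_block block_eltK.
  rewrite (_ : (block_elt s == a i) = (s == block_rank i (a i))) //.
  by apply/eqP/eqP => [<-|->]; rewrite ?block_eltK ?block_rankK.
rewrite (block_pointE awz cE (corresponds_proportionall nzwz wzL' gL')).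
apply: gchart_fraction => i j; rewrite cE !inE /T /block_coord.
case: (b i =P b j) => [ij|_ _ _]; last by rewrite /peval meval0.
rewrite {2}ij; case: (tau (b j)).
  move=> /eqP/eqP ia ja; rewrite peval_prod_entry (wz1 i ia) divr1 /wz.
  by move: ja; rewrite eqb_id => /negPf ->.
rewrite !eqbF_neg negbK pevalN peval_prod_entry => ia /eqP ja.
by rewrite (wz1 j ja) divr1 /wz (negPf ia).
Qed.

Lemma block_points_isomorphic_enum : isomorphic (block_points b tau : set M) [set: N]%classic.
Proof.
(* A default value for [f] off [block_points]. *)
have [L0 _] : exists L, line_point (fun=> 1) L.
  by apply: line_point_exists => i; have [l li] := bsurj i; exists l; rewrite oner_eq0.
have /choice[f fP] : forall V, exists L, block_points b tau V -> corresponds V L.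
  move=> V; have [/corresponds_exr[L VL]|nV] := EM (block_points b tau V); first by exists L.
  by exists L0.
have /choice[g gP] := corresponds_exl.
have gZ L : block_points b tau (g L) by have [w [nzw wV _]] := gP L; exists w.
exists f, g; split.
- exact: regular_to_lines.
- exact: regular_from_lines.
- by move=> V /fP VfV; split=> //; apply: corresponds_funl (gP _) VfV.
- by move=> L _; split=> //; apply: corresponds_funr (fP _ (gZ L)) (gP L).
Qed.

End BlockIsomorphism.

Lemma block_points_isomorphic (F : fieldType) n k r (b : 'I_n -> 'I_r)
    (tau : 'I_r -> bool) :
  (forall i, exists l, b l = i) -> (\sum_i block_dim b tau i)%N = k ->
  isomorphic (block_points b tau : set (Gr F 'I_n k))
    [set: prod_charted (fun i => proj_space F #|block b i|.-1)]%classic.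
Proof.
move=> bsurj dim_sum; pose erk i := cid (block_enum (bsurj i)).
apply: (@block_points_isomorphic_enum F n k r b tau bsurj dim_sum
  (fun i => (projT1 (erk i)).1) (fun i => (projT1 (erk i)).2)) => i.
- by have [h _ _] := projT2 (erk i).
- by have [_ h _] := projT2 (erk i).
- by have [_ _ h] := projT2 (erk i).
Qed.

Theorem theoremA (R : realType) (n k : nat) (hn : (1 <= n)%N) (hk : (k <= n)%N)
    (X : Gr R[i] 'I_n k) (hX : smooth (orbit_closure X)) :
  (exists (r : nat) (J : 'I_r -> {set 'I_n}) (kk : 'I_r -> nat),
     [/\ ordered_partition J,
         (\sum_i kk i)%N = k,
         (forall i, kk i \in [:: 0; 1; #|J i| - 1; #|J i|]%N)
       & orbit_closure X = Gr_product J kk]) /\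
  (exists (s : nat) (m : 'I_s -> nat),
     isomorphic (orbit_closure X)
                ([set: prod_charted (fun i => proj_space R[i] (m i))])%classic).
Proof.
have [r [b [tau [w [bsurj w0 wX]]]]] := smooth_block_space hX.
have nzw : block_nonzero b w by move=> i; have [l li] := bsurj i; exists l.
have closureE := orbit_closure_block_points nzw w0 wX.
have dim_sum : (\sum_i block_dim b tau i)%N = k.
  have [c [Y XE]] := gchart_surj X; rewrite XE in wX.
  have [a [aw cE]] := block_point_section nzw wX.
  have <- : #|val c| = k by apply/eqP; apply: (valP c).
  by rewrite cE card_block_basis // => i; have [] := aw i.
split; last first.
  exists r, (fun i => #|block b i|.-1); rewrite closureE.
  exact: block_points_isomorphic.
exists r, (block b), (block_dim b tau); split=> //.
- split=> [i|i j ij|].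
  + by have [l li] := bsurj i; apply/set0Pn; exists l; rewrite inE li.
  + apply/setP => l; rewrite !inE; apply/negP => /andP[/eqP -> /eqP ij'].
    by rewrite ij' eqxx in ij.
  + by apply/setP => l; rewrite inE; apply/bigcupP; exists (b l); rewrite ?inE.
(* Only 1 and [#|J i| - 1] are used; on a singleton block these are [#|J i|] and 0. *)
- by move=> i; rewrite /block_dim; case: ifP => _; rewrite !inE eqxx ?orbT.
- by rewrite closureE -Gr_product_block_points.
Qed.
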